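(* Let $\mu$ be a positive measure with support on the closed unit disk $\overline{\mathbb{D}}$, let $\nu=\mu/\mathbb{T}$ be the restriction of $\mu$ to the unit circle $\mathbb{T}$, and let $\nu=\nu_a+\nu_s$ be the Lebesgue decomposition of $\nu$ ($\nu_a$ absolutely continuous and $\nu_s$ singular with respect to Lebesgue measure $\mathbf{m}$ on $\mathbb{T}$). If $\lim_{n\to\infty}\lambda_n(\mu)>0$, then (1) $\|\mathcal{A}(\mu)\|=\|\mathcal{A}(\nu)\|=\|\mathcal{A}(\nu_a)\|$; (2) $\mathbf{A}(\nu)[0,0]=\mathbf{A}(\nu_a)[0,0]$.
   Context: For a positive Borel measure $\sigma$ on $\mathbb{C}$ with finite moments, $\mathbf{M}(\sigma)=(c_{i,j})_{i,j=0}^\infty$ with $c_{i,j}=\int z^i\overline{z}^j\,d\sigma$ is its moment matrix and $\lambda_n(\sigma)$ is the smallest eigenvalue of $(c_{i,j})_{i,j=0}^n$. When all truncations have positive determinant (HPD), $P_n(z)=\sum_{k=0}^n b_{k,n}(\sigma)z^k$, $b_{n,n}(\sigma)>0$, are the orthonormal polynomials in $L^2(\sigma)$, and the transition matrix is the upper triangular matrix $\mathbf{B}(\sigma)=(b_{k,n}(\sigma))_{k,n=0}^\infty$ ($b_{k,n}=0$ for $k>n$). $\mathbf{A}(\sigma)=\overline{\mathbf{B}(\sigma)}\mathbf{B}(\sigma)^t$ is the formal product with entries $\mathbf{A}(\sigma)[i,j]=\sum_{k\ge\max\{i,j\}}\overline{b_{i,k}}\,b_{j,k}$, and $\mathcal{A}(\sigma)$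 is the bounded operator on $\ell_2$ defined by $\mathbf{A}(\sigma)$ (through $x\mapsto\mathbf{A}(\sigma)x^t$), with operator norm $\|\cdot\|$. *)

(* Defs.v *)
From mathcomp Require Import all_boot all_order all_algebra.
From mathcomp Require Import complex.
From mathcomp Require Import all_classical all_reals all_analysis measurable_realfun.

Set Implicit Arguments.
Unset Strict Implicit.
Unset Printing Implicit Defensive.
Import Order.TTheory GRing.Theory Num.Theory.
Import numFieldNormedType.Exports.

Local Open Scope classical_set_scope.
Local Open Scope ring_scope.
Local Open Scope complex_scope.

(** [R[i]] seen as a field with a modulus, from which it gets its topology; used
    as the type of the terms of sequences and series whose limits are taken. *)

Definition Cfield (R : realType) : numFieldType := R[i].

(** Measures on the complex plane live on [R * R], whose product sigma-algebra
    is the Borel one; [toC] is the identification with [R[i]]. *)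

Definition toC (R : realType) (p : R * R) : R[i] := p.1 +i* p.2.

Definition closed_disk (R : realType) : set (R * R) :=
  [set p | Normc.normc (toC p) <= 1].

Definition unit_circle (R : realType) : set (R * R) :=
  [set p | Normc.normc (toC p) = 1].

Arguments closed_disk R : clear implicits.
Arguments unit_circle R : clear implicits.

Lemma measurable_unit_circle (R : realType) : measurable (unit_circle R).
Proof.
have -> : unit_circle R =
    (fun p : R * R => p.1 ^+ 2 + p.2 ^+ 2) @^-1` [set 1].
  apply/seteqP; split => -[x y] /=; rewrite /unit_circle /toC /=.
    move=> h; rewrite -[LHS]sqr_sqrtr ?addr_ge0 ?sqr_ge0 //.
    by rewrite h expr1n.
  by move=> ->; rewrite sqrtr1.
rewrite -[X in measurable X]setTI.
have mf : measurable_fun setT (fun p : R * R => p.1 ^+ 2 + p.2 ^+ 2).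
  apply: measurable_funD; apply: measurable_funX.
    exact: measurable_fst.
  exact: measurable_snd.
by apply: mf => //; exact: measurable_set1.
Qed.

Definition circle_param (R : realType) (t : R) : R * R := (cos t, sin t).

Lemma measurable_circle_param (R : realType) :
  measurable_fun setT (@circle_param R).
Proof.
apply: measurable_fun_pair; apply: continuous_measurable_fun.
  exact: continuous_cos.
exact: continuous_sin.
Qed.

(** Arc length; the normalization by [2 * pi] is omitted because only the null
    sets of this measure matter for a Lebesgue decomposition. *)
Definition circle_measure (R : realType) : set (R * R) -> \bar R :=
  pushforward
    (mrestr (@lebesgue_measure R) (measurable_itv `[0, 2 * pi[%R))
    (@circle_param R).

Arguments circle_measure R : clear implicits.

Definition restr_circle (R : realType)
    (mu : {measure set (R * R) -> \bar R}) : {measure set (R * R) -> \bar R} :=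
  mrestr mu (@measurable_unit_circle R).

Definition topological_support (R : realType)
    (mu : set (R * R) -> \bar R) : set (R * R) :=
  [set p | forall U : set (R * R), open U -> U p -> (0 < mu U)%E].

Definition mutually_singular (R : realType)
    (m1 m2 : set (R * R) -> \bar R) : Prop :=
  exists S : set (R * R), [/\ measurable S, m1 (~` S) = 0%E & m2 S = 0%E].

Definition lebesgue_decomposition (R : realType)
    (nu nu_a nu_s : {measure set (R * R) -> \bar R}) : Prop :=
  [/\ forall S : set (R * R), measurable S -> nu S = (nu_a S + nu_s S)%E,
      nu_a `<< circle_measure R
    & mutually_singular nu_s (circle_measure R)].

Definition finite_moments (R : realType)
    (mu : {measure set (R * R) -> \bar R}) : Prop :=
  forall n : nat,
    mu.-integrable setT (fun p => (Normc.normc (toC p) ^+ n)%:E).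

Definition cintegral (R : realType) (mu : {measure set (R * R) -> \bar R})
    (f : R[i] -> R[i]) : R[i] :=
  (\int[mu]_p complex.Re (f (toC p))) +i* (\int[mu]_p complex.Im (f (toC p))).

Definition moment (R : realType) (mu : {measure set (R * R) -> \bar R})
    (i j : nat) : R[i] :=
  cintegral mu (fun z => z ^+ i * (z^*) ^+ j).

Definition moment_section (R : realType)
    (mu : {measure set (R * R) -> \bar R}) (n : nat) : 'M[R[i]]_n.+1 :=
  \matrix_(i < n.+1, j < n.+1) moment mu i j.

(** Sections are Hermitian, so the set below is the whole spectrum: it is finite
    and nonempty, and the infimum is a minimum. *)
Definition smallest_eigenvalue (R : realType)
    (mu : {measure set (R * R) -> \bar R}) (n : nat) : R :=
  inf [set x : R | eigenvalue (moment_section mu n) x%:C].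

(** In [R[i]], [0 < z] means that [z] is real and positive. *)
Definition HPD (R : realType) (mu : {measure set (R * R) -> \bar R}) : Prop :=
  forall n : nat, 0 < \det (moment_section mu n).

Definition is_orthonormal_sequence (R : realType)
    (mu : {measure set (R * R) -> \bar R}) (P : nat -> {poly R[i]}) : Prop :=
  (forall n, size (P n) = n.+1 /\ 0 < lead_coef (P n)) /\
  (forall m n, cintegral mu (fun z => (P m).[z] * ((P n).[z])^*)
               = (m == n)%:R).

(** Such a sequence exists and is unique when [mu] is [HPD]. *)
Definition orthonormal_polynomials (R : realType)
    (mu : {measure set (R * R) -> \bar R}) : nat -> {poly R[i]} :=
  xget (fun=> 0) [set P | is_orthonormal_sequence mu P].

Definition transition_matrix (R : realType)
    (mu : {measure set (R * R) -> \bar R}) (k n : nat) : R[i] :=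
  (orthonormal_polynomials mu n)`_k.

Definition A_partial (R : realType) (mu : {measure set (R * R) -> \bar R})
    (i j N : nat) : Cfield R :=
  \sum_(maxn i j <= k < N)
    (transition_matrix mu i k)^* * transition_matrix mu j k.

Definition A_matrix (R : realType) (mu : {measure set (R * R) -> \bar R})
    (i j : nat) : Cfield R :=
  limn (A_partial mu i j).

Definition in_l2 (R : realType) (x : nat -> Cfield R) : Prop :=
  cvgn [series Normc.normc (x k) ^+ 2]_k.

Definition l2norm (R : realType) (x : nat -> Cfield R) : R :=
  Num.sqrt (limn [series Normc.normc (x k) ^+ 2]_k).

Definition matrix_apply (R : realType) (A : nat -> nat -> Cfield R)
    (x : nat -> Cfield R) (i : nat) : Cfield R :=
  limn [series A i j * x j]_j.

Definition defines_bounded_operator (R : realType)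
    (A : nat -> nat -> Cfield R) : Prop :=
  (forall x, in_l2 x -> (forall i, cvgn [series A i j * x j]_j) /\
                        in_l2 (matrix_apply A x)) /\
  (exists M : R, forall x, in_l2 x ->
                   l2norm (matrix_apply A x) <= M * l2norm x).

Definition operator_norm (R : realType) (A : nat -> nat -> Cfield R) : R :=
  sup [set l2norm (matrix_apply A x) | x in
         [set x : nat -> Cfield R | in_l2 x /\ l2norm x <= 1]].

(** The limits and suprema above are total functions; this says that those
    involved in [A_matrix mu] and its operator norm are genuine. *)
Definition A_operator_exists (R : realType)
    (mu : {measure set (R * R) -> \bar R}) : Prop :=
  [/\ HPD mu,
      forall i j, cvgn (A_partial mu i j)
    & defines_bounded_operator (A_matrix mu)].

(* Main.v *)
Require Import Defs.
From mathcomp Require Import all_boot all_order all_algebra.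
From mathcomp Require Import complex.
From mathcomp Require Import all_classical all_reals all_analysis.
From mathcomp Require Import measurable_realfun.
From mathcomp Require Import ring lra.
Set Implicit Arguments.
Unset Strict Implicit.
Unset Printing Implicit Defensive.
Import Order.TTheory GRing.Theory Num.Theory.
Import numFieldNormedType.Exports.
Local Open Scope classical_set_scope.
Local Open Scope ring_scope.

(** The operator norms and the entries A[0,0] are best constants of inequalities
    between the coefficients of a polynomial and its energy. Write nu for the
    restriction of mu to the circle; for a measure sigma let Q(p) be the integral of
    |p|^2, and call d a bound of order n when
    \sum_(i < n) |p_i|^2 <= d Q(p) for every polynomial p ([coef_bound]).

    Let P_k be the orthonormal polynomials and p = \sum_k y_k P_k. Then
    Q(p) = \sum_k |y_k|^2, so the partial sums of A(sigma) are inverses of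
    Gram matrices, and Cauchy-Schwarz converts bounds on coefficients into bounds on
    A(sigma) and conversely. The norm of the operator is the least d that is a
    bound of every order ([operator_norm_A_le], [coef_bound_operator_norm]), and
    A[0,0] is the least bound of order 1 ([A00_le], [coef_bound_A00]). A positive
    limit of the smallest eigenvalues provides a d that is a bound of every order
    for mu ([coef_bound_of_limn]), and this makes all the limits that define
    A(mu) converge. It remains to compare the bounds of mu, nu and nu_a.

    Since nu_a <= nu <= mu, bounds pass from nu_a to nu and from nu to mu.

    From mu to nu, apply the bound to X^k p: its coefficients are those of p,
    shifted, while |z|^(2k) decreases on the disk to the indicator of the circle
    ([coef_bound_restr_circle]).

    From nu to nu_a ([coef_bound_ac]), the singular part is erased by a polynomial
    multiplier q = (1 - h / N)^N, where Re h >= 0 on the circle, Re h is large on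
    most of nu_s, and h(0) >= 0 is small. On the circle |q|^2 is about
    exp(-2 Re h), hence at most about 1, and tiny on most of nu_s. As q(0) is about
    exp(-h(0)), close to 1, and the coefficients of q have sum of squares at most
    about 1, q is close to 1 in l2. So Q_nu(p q) is at most about Q_{nu_a}(p),
    whereas p q has almost the coefficients of p ([singular_damping]). To build h,
    cover the Lebesgue null set that carries nu_s by arcs of small total length,
    finitely many of which suffice up to a small mass. A normalized geometric sum
    s is at least 1/2 on an arc of length l and its coefficients have sum of
    squares at most 2l ([arc_poly]); and |s|^2 is on the circle the real part of a
    polynomial whose value at 0 is that sum of squares ([analytic_completion]).
    This gives the part of Szego's theorem that is used, namely that Christoffel
    functions do not see the singular part, without the formula for their
    limit. *)

Local Notation normc := Normc.normc.

(** * Hermitian forms on polynomials *)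

Lemma cauchy_schwarz_sum (C : numClosedFieldType) (n : nat) (x y : nat -> C) :
  `|\sum_(i < n) x i * y i| ^+ 2 <=
    (\sum_(i < n) `|x i| ^+ 2) * \sum_(i < n) `|y i| ^+ 2.
Proof.
pose u : 'rV[C]_n := \row_i x i; pose v : 'rV[C]_n := \row_i (y i)^*.
have dotE (a b : 'rV[C]_n) : dotmx a b = \sum_i a 0 i * (b 0 i)^*.
  by rewrite dotmxE mxE; apply: eq_bigr => i _; rewrite !mxE.
have : `|dotmx u v| ^+ 2 <= dotmx u u * dotmx v v.
  by case: (CauchySchwarz (@dotmx C n) u v).
rewrite !dotE.
under eq_bigr do rewrite !mxE conjCK.
under [X in _ <= X * _ -> _]eq_bigr do rewrite !mxE -normCK.
by under [X in _ <= _ * X -> _]eq_bigr do rewrite !mxE -normCK norm_conjC.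
Qed.

Section HermitianForm.
Variables (C : numClosedFieldType) (B : {poly C} -> {poly C} -> C).
Hypothesis BP : forall a (p q r : {poly C}), B (a *: p + q) r = a * B p r + B q r.
Hypothesis BJ : forall p q : {poly C}, B q p = (B p q)^*.
Hypothesis Bpos : forall p : {poly C}, p != 0 -> 0 < B p p.

Lemma form0l p : B 0 p = 0.
Proof.
by have := BP (-1) 0 0 p; rewrite scaleN1r oppr0 addr0 mulN1r addNr.
Qed.

Lemma formZl a p q : B (a *: p) q = a * B p q.
Proof. by rewrite -[a *: p]addr0 BP form0l addr0. Qed.

Lemma formDl p q r : B (p + q) r = B p r + B q r.
Proof. by rewrite -[p]scale1r BP scale1r mul1r. Qed.

Lemma formBl p q r : B (p - q) r = B p r - B q r.
Proof. by rewrite formDl -scaleN1r formZl mulN1r. Qed.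

Lemma formZr a p q : B p (a *: q) = a^* * B p q.
Proof. by rewrite BJ formZl rmorphM [B p q]BJ. Qed.

Lemma formDr p q r : B p (q + r) = B p q + B p r.
Proof. by rewrite BJ formDl rmorphD [B p q]BJ [B p r]BJ. Qed.

Lemma form0r p : B p 0 = 0.
Proof. by rewrite BJ form0l rmorph0. Qed.

Lemma form_suml n (F : nat -> {poly C}) q :
  B (\sum_(k < n) F k) q = \sum_(k < n) B (F k) q.
Proof.
by elim/big_rec2: _ => [|i a b _ <-]; rewrite ?form0l// formDl.
Qed.

Lemma form_sumr n (F : nat -> {poly C}) p :
  B p (\sum_(k < n) F k) = \sum_(k < n) B p (F k).
Proof.
by elim/big_rec2: _ => [|i a b _ <-]; rewrite ?form0r// formDr.
Qed.

Lemma sub_lead_size n (g r : {poly C}) : (size g <= n.+1)%N ->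
  (size r <= n.+1)%N -> r`_n = g`_n -> (size (g - r)%R <= n)%N.
Proof.
move=> sg sr er; apply/leq_sizeP => j.
rewrite leq_eqVlt coefB => /predU1P[<-|ltnj]; first by rewrite er subrr.
by rewrite !nth_default ?subrr// (leq_trans _ ltnj).
Qed.

(** Gram-Schmidt in the form of orthogonal projections onto the polynomials of
    size at most n. The step from n to n+1 projects once more onto the line spanned
    by the error f made in projecting the monomial of degree n. *)
Lemma form_proj n (p : {poly C}) : exists2 r : {poly C}, (size r <= n)%N &
  forall g : {poly C}, (size g <= n)%N -> B (p - r) g = 0.
Proof.
elim: n p => [|n IHn] p.
  by exists 0 => [|g]; rewrite ?size_poly0// leqn0 size_poly_eq0 => /eqP->; rewrite form0r.
have [r sr rP] := IHn p; have [s ss sP] := IHn 'X^n.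
pose f := 'X^n - s.
have fn : f`_n = 1 by rewrite coefB coefXn eqxx nth_default// subr0.
have f0 : f != 0 by apply: contra_eq_neq fn => ->; rewrite coef0 eq_sym oner_neq0.
have sf : (size f <= n.+1)%N.
  by rewrite (leq_trans (size_polyD _ _))// size_polyN size_polyXn geq_max leqnn leqW.
exists (r + (B (p - r) f / B f f) *: f) => [|g sg].
  rewrite (leq_trans (size_polyD _ _))// geq_max leqW//=.
  exact: leq_trans (size_scale_leq _ _) sf.
have -> : g = g`_n *: f + (g - g`_n *: f) by rewrite addrC subrK.
have sg' : (size (g - g`_n *: f)%R <= n)%N.
  apply: sub_lead_size => //; first exact: leq_trans (size_scale_leq _ _) sf.
  by rewrite coefZ fn mulr1.
rewrite opprD [p + (_ + _)]addrA formDr formZr.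
rewrite [B _ f]formBl formZl mulfVK ?lt0r_neq0 ?Bpos// subrr mulr0 add0r.
by rewrite [B (_ - _ *: _) _]formBl formZl (rP _ sg') (sP _ sg') mulr0 subr0.
Qed.

Lemma gram_schmidt : exists P : nat -> {poly C},
  (forall n, size (P n) = n.+1 /\ 0 < lead_coef (P n)) /\
  (forall m n, B (P m) (P n) = (m == n)%:R).
Proof.
have ex n : exists p : {poly C}, [/\ size p = n.+1, 0 < lead_coef p, B p p = 1
    & forall g : {poly C}, (size g <= n)%N -> B p g = 0].
  have [s ss sP] := form_proj n 'X^n; pose f := 'X^n - s.
  have sf : size f = n.+1.
    by rewrite size_polyDl ?size_polyXn// size_polyN ltnS.
  have lf : lead_coef f = 1.
    by rewrite lead_coefDl ?lead_coefXn// size_polyXn size_polyN ltnS.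
  have f0 : f != 0 by rewrite -size_poly_eq0 sf.
  have Bf := Bpos f0; pose a := (sqrtC (B f f))^-1.
  have a0 : 0 < a by rewrite invr_gt0 sqrtC_gt0.
  exists (a *: f); split.
  - by rewrite size_scale ?lt0r_neq0.
  - by rewrite lead_coefZ lf mulr1.
  - rewrite formZl formZr (CrealP (gtr0_real a0)) mulrA -expr2 exprVn sqrtCK.
    by rewrite mulVf ?lt0r_neq0.
  - by move=> g sg; rewrite formZl sP// mulr0.
have [P PP] := choice ex.
exists P; split=> [n|m n]; first by case: (PP n).
wlog lenm : m n / (n <= m)%N => [hw|].
  have [/hw//|/ltnW/hw h] := leqP n m.
  by rewrite BJ h conjC_nat eq_sym.
have [_ _ Bp pP] := PP m; move: lenm; rewrite leq_eqVlt => /predU1P[->|ltnm].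
  by have [_ _ -> _] := PP m; rewrite eqxx.
by have [sq _ _ _] := PP n; rewrite pP ?sq// gtn_eqF.
Qed.

Section Orthonormal.
Variable P : nat -> {poly C}.
Hypothesis sP : forall n, size (P n) = n.+1.
Hypothesis oP : forall m n, B (P m) (P n) = (m == n)%:R.

Lemma diag_neq0 n : (P n)`_n != 0.
Proof.
have -> : (P n)`_n = lead_coef (P n) by rewrite lead_coefE sP.
by rewrite lead_coef_eq0 -size_poly_eq0 sP.
Qed.

Lemma form_comb N (y z : nat -> C) :
  B (\sum_(k < N) y k *: P k) (\sum_(k < N) z k *: P k) =
  \sum_(k < N) y k * (z k)^*.
Proof.
rewrite (form_suml _ (fun k => y k *: P k)); apply: eq_bigr => k _.
rewrite (form_sumr _ (fun k => z k *: P k)) (bigD1 k)//= big1 => [|j jk].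
  by rewrite formZl formZr oP eqxx mulr1 addr0.
by rewrite formZl formZr oP eq_sym (inj_eq val_inj) (negPf jk) !mulr0.
Qed.

(** Division by the leading coefficients, which are nonzero: P_k has degree
    exactly k. *)
Lemma comb_exists n (p : {poly C}) : (size p <= n)%N ->
  exists y : nat -> C, p = \sum_(k < n) y k *: P k.
Proof.
elim: n p => [|n IHn] p sp.
  by exists (fun=> 0); rewrite big_ord0; apply/eqP; rewrite -size_poly_leq0.
pose a := p`_n / (P n)`_n.
have ln := diag_neq0 n.
have [y py] : exists y : nat -> C, p - a *: P n = \sum_(k < n) y k *: P k.
  apply: IHn; apply: sub_lead_size => //.
    by rewrite (leq_trans (size_scale_leq _ _))// sP.
  by rewrite coefZ divfK.
exists (fun k => if k == n then a else y k).
rewrite big_ord_recr /= eqxx -[LHS](subrK (a *: P n)) py; congr (_ + _).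
by apply: eq_bigr => k _; rewrite ltn_eqF.
Qed.

(** For i, j < N these are the entries of the inverse of the Gram matrix of
    1, ..., X^(N-1). *)
Definition gram_inv N i j : C := \sum_(k < N) ((P k)`_i)^* * (P k)`_j.

Lemma coef_comb N (y : nat -> C) i :
  (\sum_(k < N) y k *: P k)`_i = \sum_(k < N) y k * (P k)`_i.
Proof. by rewrite coef_sum; apply: eq_bigr => k _; rewrite coefZ. Qed.

(** Test the bound on the reproducing polynomial
    p = \sum_(k < N) conj (P_k)_i P_k, whose i-th coefficient and whose energy are
    both the sum S to be estimated: S^2 <= c S. *)
Lemma gram_inv_diag_le n (c : C) i N : 0 <= c -> (i < n)%N ->
  (forall p : {poly C}, \sum_(l < n) `|p`_l| ^+ 2 <= c * B p p) ->
  \sum_(k < N) `|(P k)`_i| ^+ 2 <= c.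
Proof.
move=> c0 lt_in cP; set S := \sum_(k < N) _.
have S0 : 0 <= S by apply: sumr_ge0 => k _; rewrite exprn_ge0.
have [->//|Sn0] := eqVneq S 0.
have Sgt0 : 0 < S by rewrite lt_def Sn0.
pose p := \sum_(k < N) ((P k)`_i)^* *: P k.
have Bp : B p p = S.
  rewrite (form_comb _ (fun k => ((P k)`_i)^*) (fun k => ((P k)`_i)^*)).
  by apply: eq_bigr => k _; rewrite conjCK normCKC.
have pi : p`_i = S.
  rewrite (coef_comb _ (fun k => ((P k)`_i)^*)).
  by apply: eq_bigr => k _; rewrite normCKC.
have := cP p; rewrite Bp (bigD1 (Ordinal lt_in))//= pi => h.
have : `|S| ^+ 2 <= c * S.
  by apply: le_trans h; rewrite lerDl sumr_ge0// => k _; rewrite exprn_ge0.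
by rewrite ger0_norm// expr2 ler_pM2r.
Qed.

(** The vector obtained by applying the section to x is conjugate to the
    coefficients of p = \sum_k conj y_k P_k, with y_k = \sum_j (P_k)_j x_j, and
    B p p = S = \sum_k |y_k|^2. Pairing p with x gives back S, so Cauchy-Schwarz and
    the bound yield S^2 <= c S |x|^2, that is S <= c |x|^2, and the bound used a
    second time gives the claim. *)
Lemma gram_inv_apply_le (c : C) N I m (x : nat -> C) : 0 <= c ->
  (forall n (p : {poly C}), \sum_(l < n) `|p`_l| ^+ 2 <= c * B p p) ->
  \sum_(i < I) `|\sum_(j < m) gram_inv N i j * x j| ^+ 2 <=
    c ^+ 2 * \sum_(j < m) `|x j| ^+ 2.
Proof.
move=> c0 cP; pose y k := \sum_(j < m) (P k)`_j * x j.
pose p := \sum_(k < N) (y k)^* *: P k.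
set X := \sum_(j < m) _; pose S := \sum_(k < N) `|y k| ^+ 2.
have Bp : B p p = S.
  rewrite (form_comb _ (fun k => (y k)^*) (fun k => (y k)^*)).
  by apply: eq_bigr => k _; rewrite conjCK normCKC.
have pE i : p`_i = (\sum_(j < m) gram_inv N i j * x j)^*.
  rewrite (coef_comb _ (fun k => (y k)^*)) rmorph_sum/=.
  under [RHS]eq_bigr do rewrite /gram_inv mulr_suml rmorph_sum/=.
  rewrite exchange_big/=; apply: eq_bigr => k _.
  rewrite rmorph_sum mulr_suml; apply: eq_bigr => j _.
  by rewrite !rmorphM /= conjCK mulrC mulrA.
under eq_bigr do rewrite -norm_conjC -pE.
apply: (le_trans (cP I p)); rewrite Bp expr2 -mulrA ler_wpM2l//.
have S0 : 0 <= S by apply: sumr_ge0 => k _; rewrite exprn_ge0.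
have X0 : 0 <= X by apply: sumr_ge0 => k _; rewrite exprn_ge0.
have [->|Sn0] := eqVneq S 0; first by rewrite mulr_ge0.
have Sgt0 : 0 < S by rewrite lt_def Sn0.
have SE : S = \sum_(j < m) p`_j * x j.
  under eq_bigr do rewrite (coef_comb _ (fun k => (y k)^*)) mulr_suml.
  rewrite exchange_big/=; apply: eq_bigr => k _.
  rewrite normCKC {2}/y mulr_sumr; apply: eq_bigr => j _.
  by rewrite mulrA.
have := cauchy_schwarz_sum m (fun j => p`_j) x; rewrite -SE -/X ger0_norm// => h.
have : S ^+ 2 <= c * S * X.
  by apply: (le_trans h); rewrite ler_wpM2r// -Bp.
by rewrite expr2 mulrAC ler_pM2r.
Qed.

(** Cauchy-Schwarz for p_i = \sum_k y_k (P_k)_i. *)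
Lemma coef_le_gram_inv n N (p : {poly C}) i : (size p <= n)%N -> (n <= N)%N ->
  `|p`_i| ^+ 2 <= B p p * gram_inv N i i.
Proof.
move=> sp leN; have [y ->] := comb_exists (leq_trans sp leN).
rewrite coef_comb form_comb; apply: (le_trans (cauchy_schwarz_sum N y (fun k => (P k)`_i))).
rewrite le_eqVlt; apply/orP; left; apply/eqP; congr (_ * _).
  by apply: eq_bigr => k _; rewrite normCK.
by apply: eq_bigr => k _; rewrite normCKC.
Qed.

(** Converse of [gram_inv_apply_le]: expand p on the P_k and apply
    Cauchy-Schwarz to \sum_k y_k w_k, where w_k pairs P_k with the coefficients of
    p. *)
Lemma norm_le_gram_inv n N (p : {poly C}) : (size p <= N)%N ->
  (\sum_(i < n) `|p`_i| ^+ 2) ^+ 2 <=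
    B p p * \sum_(i < n) p`_i * \sum_(j < n) gram_inv N i j * (p`_j)^*.
Proof.
move=> sp; have [y py] := comb_exists sp.
pose w k := \sum_(j < n) (P k)`_j * (p`_j)^*.
have SE : \sum_(i < n) `|p`_i| ^+ 2 = \sum_(k < N) y k * w k.
  under eq_bigr do rewrite normCK {1}py coef_comb mulr_suml.
  rewrite exchange_big/=; apply: eq_bigr => k _.
  by rewrite mulr_sumr; apply: eq_bigr => j _; rewrite mulrA.
have -> : \sum_(i < n) p`_i * (\sum_(j < n) gram_inv N i j * (p`_j)^*) =
    \sum_(k < N) `|w k| ^+ 2.
  under eq_bigr do under eq_bigr do rewrite mulr_suml.
  under eq_bigr do rewrite exchange_big/= mulr_sumr.
  rewrite exchange_big/=; apply: eq_bigr => k _.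
  rewrite normCKC {1}/w rmorph_sum mulr_suml; apply: eq_bigr => i _.
  rewrite rmorphM /= conjCK.
  have -> : \sum_(j < n) ((P k)`_i)^* * (P k)`_j * (p`_j)^* = ((P k)`_i)^* * w k.
    by rewrite mulr_sumr; apply: eq_bigr => j _; rewrite mulrA.
  by rewrite mulrCA mulrA.
have Bp : B p p = \sum_(k < N) `|y k| ^+ 2.
  by rewrite py form_comb; apply: eq_bigr => k _; rewrite normCK.
rewrite Bp -(@ger0_norm _ (\sum_(i < n) _)); last first.
  by apply: sumr_ge0 => i _; rewrite exprn_ge0.
by rewrite SE; exact: cauchy_schwarz_sum N y w.
Qed.

(** If the rows of L hold the coefficients of P_0, ..., P_n and M is the Gram
    matrix, then orthonormality says that L M L^* = 1, so det M = |det L|^-2. *)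
Lemma det_gram_gt0 n : 0 < \det (\matrix_(i < n.+1, j < n.+1) B 'X^i 'X^j).
Proof.
set M := matrix_of_fun _ _.
pose L : 'M[C]_n.+1 := \matrix_(k, i) (P k)`_i.
have LML : L *m M *m (map_mx Num.conj L)^T = 1%:M.
  apply/matrixP => m k; rewrite !mxE.
  have PE (l : 'I_n.+1) : P l = \sum_(i < n.+1) (P l)`_i *: 'X^i.
    apply/polyP => i; rewrite coef_sum; under eq_bigr do rewrite coefZ coefXn.
    have [lt_in|le_ni] := ltnP i n.+1.
      rewrite (bigD1 (Ordinal lt_in))//= eqxx mulr1 big1 ?addr0// => j ji.
      by rewrite eq_sym (negPf (ji : j != Ordinal lt_in :> nat)) mulr0.
    rewrite nth_default ?sP ?(leq_trans _ le_ni)// big1// => j _.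
    by rewrite gtn_eqF ?mulr0// (leq_trans (ltn_ord j)).
  rewrite -[RHS](oP m k) (PE m) (PE k).
  rewrite (form_sumr _ (fun i => (P k)`_i *: 'X^i)); apply: eq_bigr => j _.
  rewrite formZr (form_suml _ (fun i => (P m)`_i *: 'X^i)) !mxE mulrC.
  by congr (_ * _); apply: eq_bigr => i _; rewrite formZl !mxE.
have L0 : \det L != 0.
  rewrite det_trig; last first.
    by apply/is_trig_mxP => i j ij; rewrite !mxE nth_default// sP.
  by apply/prodf_neq0 => i _; rewrite !mxE diag_neq0.
have := congr1 determinant LML.
rewrite !det_mulmx det_tr det_map_mx det1 mulrAC -normCK.
move=> /(canRL (mulKf _))->; last by rewrite expf_neq0// normr_eq0.
by rewrite mulr1 invr_gt0 exprn_gt0// normr_gt0.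
Qed.
End Orthonormal.
End HermitianForm.

(** * Limits of complex sequences and of matrices *)

Section ComplexLimits.
Variable R : realType.
Implicit Types (z : R[i]) (u : nat -> Cfield R).

Lemma Re_sum n (z : nat -> R[i]) :
  complex.Re (\sum_(k < n) z k) = \sum_(k < n) complex.Re (z k).
Proof. by elim/big_rec2: _ => // k a [? ?] _ <-; case: (z k). Qed.

Lemma Im_sum n (z : nat -> R[i]) :
  complex.Im (\sum_(k < n) z k) = \sum_(k < n) complex.Im (z k).
Proof. by elim/big_rec2: _ => // k a [? ?] _ <-; case: (z k). Qed.

Lemma normc_ge0 z : 0 <= normc z.
Proof. by case: z => a b; exact: sqrtr_ge0. Qed.

Lemma normcJ z : normc (z^*)%C = normc z.
Proof. by case: z => x y /=; rewrite sqrrN. Qed.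

Lemma normcX z k : normc (z ^+ k) = normc z ^+ k.
Proof.
elim: k => [|k IHk]; first by rewrite !expr0 Normc.normc1.
by rewrite !exprS Normc.normcM IHk.
Qed.

Lemma normc_real (x : R) : normc (x%:C)%C = `|x|.
Proof. by rewrite /= expr0n addr0 sqrtr_sqr. Qed.

Lemma normc_sqr z : normc z ^+ 2 = complex.Re z ^+ 2 + complex.Im z ^+ 2.
Proof. by case: z => a b /=; rewrite sqr_sqrtr// addr_ge0 ?sqr_ge0. Qed.

Lemma Re_le_normc z : `|complex.Re z| <= normc z.
Proof.
rewrite -(@ler_pXn2r _ 2)// ?nnegrE ?normc_ge0//.
by rewrite real_normK ?num_real// normc_sqr lerDl sqr_ge0.
Qed.

Lemma Im_le_normc z : `|complex.Im z| <= normc z.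
Proof.
rewrite -(@ler_pXn2r _ 2)// ?nnegrE ?normc_ge0//.
by rewrite real_normK ?num_real// normc_sqr lerDr sqr_ge0.
Qed.

Lemma normc_le_ReIm z : normc z <= `|complex.Re z| + `|complex.Im z|.
Proof.
rewrite -(@ler_pXn2r _ 2)// ?nnegrE ?normc_ge0 ?addr_ge0//.
rewrite normc_sqr sqrrD !real_normK ?num_real// -subr_ge0.
rewrite [X in 0 <= X](_ : _ = `|complex.Re z| * `|complex.Im z| *+ 2); last by ring.
by rewrite mulrn_wge0// mulr_ge0.
Qed.

Lemma normcB_dist (x y : R[i]) : `|normc x - normc y| <= normc (x - y).
Proof.
have h1 : normc x <= normc (x - y) + normc y by rewrite -{1}[x](subrK y) le_normcD.
have h2 : normc y <= normc (x - y) + normc x.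
  by rewrite -[normc (x - y)]normcN opprB -{1}[y](subrK x) le_normcD.
by rewrite ler_norml; lra.
Qed.

(** The topology of [Cfield R] is indexed by the positive elements of R[i] itself;
    these are real, so that convergence may be tested with the real modulus. *)
Lemma cvg_normcP u (l : Cfield R) :
  u n @[n --> \oo] --> l <-> normc (u n - l) @[n --> \oo] --> (0 : R).
Proof.
split=> [/cvgrPdist_lt ul|/cvgrPdist_lt ul].
  apply/cvgrPdist_lt => e e0.
  have := ul (e%:C)%C; rewrite ltcR => /(_ e0).
  apply: filterS => n /=; rewrite -ltcR.
  by rewrite distrC sub0r normrN (ger0_norm (normc_ge0 _)).
apply/cvgrPdist_lt => e e0; have er : e \is Num.real by exact: gtr0_real.
have eE : e = (complex.Re e)%:C%C by rewrite RRe_real.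
move: e0; rewrite eE ltcR => e0; have := ul _ e0.
apply: filterS => n /=; rewrite sub0r normrN (ger0_norm (normc_ge0 _)).
by rewrite distrC -ltcR.
Qed.

Lemma cvg_normc u (l : Cfield R) : u n @[n --> \oo] --> l ->
  normc (u n) @[n --> \oo] --> normc l.
Proof.
move=> /cvg_normcP/cvgrPdist_lt ul; apply/cvgrPdist_lt => e /ul.
apply: filterS => n; rewrite sub0r normrN (ger0_norm (normc_ge0 _)).
by apply: le_lt_trans; rewrite distrC normcB_dist.
Qed.

Lemma cvg_complex u (a b : R) :
  complex.Re (u n) @[n --> \oo] --> a -> complex.Im (u n) @[n --> \oo] --> b ->
  u n @[n --> \oo] --> ((a +i* b)%C : Cfield R).
Proof.
move=> ua ub; apply/cvg_normcP.
apply: (@squeeze_cvgr _ _ _ _ (fun=> 0)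
  (fun n => `|complex.Re (u n) - a| + `|complex.Im (u n) - b|)).
- near=> n; rewrite normc_ge0/=.
  by have := normc_le_ReIm (u n - (a +i* b)%C); case: (u n).
- exact: cvg_cst.
- rewrite -[X in _ --> X]addr0; apply: cvgD.
    by apply/norm_cvg0P; rewrite -(subrr a); apply: cvgB => //; exact: cvg_cst.
  by apply/norm_cvg0P; rewrite -(subrr b); apply: cvgB => //; exact: cvg_cst.
Unshelve. all: by end_near. Qed.

Lemma cvg_finsum (K : numFieldType) n (u : nat -> nat -> K) (l : nat -> K) :
  (forall k, (k < n)%N -> u k m @[m --> \oo] --> l k) ->
  \sum_(k < n) u k m @[m --> \oo] --> \sum_(k < n) l k.
Proof.
elim: n => [|n IHn] ul.
  by rewrite big_ord0; under eq_cvg do rewrite big_ord0; exact: cvg_cst.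
rewrite big_ord_recr/=; under eq_cvg do rewrite big_ord_recr/=.
by apply: cvgD; [apply: IHn => k kn; apply: ul; exact: ltnW|exact: ul].
Qed.

Lemma cvg_sqr (v : nat -> R) (l : R) : v n @[n --> \oo] --> l ->
  v n ^+ 2 @[n --> \oo] --> l ^+ 2.
Proof. by move=> vl; rewrite expr2; exact: (cvgM vl vl). Qed.

Lemma nneg_sum_le n m (v : nat -> R) : (forall k, 0 <= v k) -> (n <= m)%N ->
  \sum_(k < n) v k <= \sum_(k < m) v k.
Proof.
move=> v0 nm; rewrite -!(big_mkord xpredT).
by rewrite [leRHS](big_cat_nat (leq0n n) nm)/= lerDl sumr_ge0.
Qed.

Lemma sum_widen (V : zmodType) n m (v : nat -> V) :
  (forall k, (n <= k)%N -> v k = 0) -> (n <= m)%N ->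
  \sum_(k < m) v k = \sum_(k < n) v k.
Proof.
move=> v0 nm; rewrite -!(big_mkord xpredT) (big_cat_nat (leq0n n) nm)/=.
rewrite [X in _ + X]big_nat_cond [X in _ + X]big1 ?addr0// => k.
by rewrite andbT => /andP[/v0].
Qed.

Lemma nneg_series_bounded (v : nat -> R) (M : R) : (forall k, 0 <= v k) ->
  (forall n, \sum_(k < n) v k <= M) ->
  cvgn [series v k]_k /\ limn [series v k]_k <= M.
Proof.
move=> v0 vM.
have vM' n : [series v k]_k n <= M by rewrite seriesEord vM.
have cv : cvgn [series v k]_k.
  apply: nondecreasing_is_cvgn.
    by apply: nondecreasing_series => // n _ _; exact: v0.
  by exists M => _ [n _ <-].
by split => //; apply: limr_le => //; near=> n; exact: vM'.
Unshelve. all: by end_near. Qed.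

Lemma nneg_series_partial_le (v : nat -> R) n : (forall k, 0 <= v k) ->
  cvgn [series v k]_k -> \sum_(k < n) v k <= limn [series v k]_k.
Proof.
move=> v0 cv; rewrite -[X in X <= _](_ : [series v k]_k n = _); last by rewrite seriesEord.
apply: nondecreasing_cvgn_le => //.
by apply: nondecreasing_series => k _ _; exact: v0.
Qed.

(** Absolute convergence of the real and of the imaginary parts. *)
Lemma dominated_complex_series u (v : nat -> R) (M : R) :
  (forall k, normc (u k) <= v k) -> (forall n, \sum_(k < n) v k <= M) ->
  cvgn [series u k]_k.
Proof.
move=> uv vM.
have v0 k : 0 <= v k := le_trans (normc_ge0 _) (uv k).
have abs_cvg (f : nat -> R) : (forall k, `|f k| <= v k) -> cvgn (series f).
  move=> fv; apply: normed_cvg.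
  have [] // := @nneg_series_bounded (fun k => `|f k|) M.
  by move=> n; apply: le_trans (vM n); apply: ler_sum => k _.
have cRe : cvgn (series (fun k => complex.Re (u k))).
  by apply: abs_cvg => k; exact: le_trans (Re_le_normc _) (uv k).
have cIm : cvgn (series (fun k => complex.Im (u k))).
  by apply: abs_cvg => k; exact: le_trans (Im_le_normc _) (uv k).
pose a := limn (series (fun k => complex.Re (u k))).
pose b := limn (series (fun k => complex.Im (u k))).
apply/cvg_ex; exists ((a +i* b)%C : Cfield R); apply: cvg_complex.
  rewrite (_ : (fun _ => _) = series (fun k => complex.Re (u k)))//.
  by apply/funext => n; rewrite seriesEord big_mkord; exact: (Re_sum n u).
rewrite (_ : (fun _ => _) = series (fun k => complex.Im (u k)))//.
by apply/funext => n; rewrite seriesEord big_mkord; exact: (Im_sum n u).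
Qed.

End ComplexLimits.

(** From uniform bounds on finite sections [G N] to the matrix [A] of their
    entrywise limits and to the operator that it defines on l2. *)
Section MatrixLimits.
Variables (R : realType) (c : R) (b : nat -> nat -> R[i]).
Hypothesis c0 : 0 <= c.
Let G N i j : Cfield R := \sum_(k < N) ((b i k)^* * b j k)%C.
Hypothesis diag_le : forall i N, \sum_(k < N) normc (b i k) ^+ 2 <= c.
Hypothesis apply_le : forall N I m (x : nat -> R[i]),
  \sum_(i < I) normc (\sum_(j < m) G N i j * x j) ^+ 2 <=
  c ^+ 2 * \sum_(j < m) normc (x j) ^+ 2.
Let A i j : Cfield R := limn (fun N => G N i j).

Lemma normcM_le (z w : R[i]) : normc (z * w) <= normc z ^+ 2 + normc w ^+ 2.
Proof.
rewrite Normc.normcM; have := sqr_ge0 (normc z - normc w).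
by have := sqr_ge0 (normc z); have := sqr_ge0 (normc w); nra.
Qed.

Lemma gram_inv_cvg i j : cvgn (fun N => G N i j).
Proof.
rewrite (_ : (fun N => _) = [series ((b i k)^*%C * b j k : Cfield R)]_k); last first.
  by apply/funext => N; rewrite seriesEord.
apply: (@dominated_complex_series _ _
  (fun k => normc (b i k) ^+ 2 + normc (b j k) ^+ 2) (c + c)).
  by move=> k; rewrite (le_trans (normcM_le _ _))// normcJ.
by move=> n; rewrite big_split lerD ?diag_le.
Qed.

Lemma limit_apply_le I m (x : nat -> R[i]) :
  \sum_(i < I) normc (\sum_(j < m) A i j * x j) ^+ 2 <=
  c ^+ 2 * \sum_(j < m) normc (x j) ^+ 2.
Proof.
have cG : \sum_(i < I) normc (\sum_(j < m) G N i j * x j) ^+ 2 @[N --> \oo] -->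
    \sum_(i < I) normc (\sum_(j < m) A i j * x j) ^+ 2.
  apply: (@cvg_finsum _ _ (fun i N => normc (\sum_(j < m) G N i j * x j) ^+ 2)
    (fun i => normc (\sum_(j < m) A i j * x j) ^+ 2)) => i _.
  apply: cvg_sqr; apply: cvg_normc.
  apply: (@cvg_finsum _ _ (fun j N => G N i j * x j) (fun j => A i j * x j)) => j _.
  by apply: cvgMl; exact: gram_inv_cvg.
rewrite -(cvg_lim _ cG)//; apply: limr_le; first by apply/cvg_ex; eexists; exact: cG.
by near=> N; exact: apply_le.
Unshelve. all: by end_near. Qed.

(** Apply [limit_apply_le] to x_j = conj A_ij and keep only row i: S^2 <= c^2 S
    for S = \sum_j |A_ij|^2. *)
Lemma limit_row_le i m : \sum_(j < m) normc (A i j) ^+ 2 <= c ^+ 2.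
Proof.
set S := \sum_(j < m) _.
have S0 : 0 <= S by apply: sumr_ge0 => j _; exact: sqr_ge0.
have := limit_apply_le i.+1 m (fun j => ((A i j)^*)%C).
rewrite big_ord_recr/=; under [X in _ <= _ * X -> _]eq_bigr do rewrite normcJ.
rewrite -/S => h.
have -> // : S <= c ^+ 2.
have hS : normc (\sum_(j < m) A i j * (A i j)^*%C) = S.
  rewrite (_ : \sum_(j < m) _ = (S%:C)%C :> R[i]); last first.
    rewrite rmorph_sum; apply: eq_bigr => j _ /=.
    by rewrite -[(_ * _)%R]normCK rmorphXn.
  by rewrite /= expr0n addr0 sqrtr_sqr ger0_norm.
have : S ^+ 2 <= c ^+ 2 * S.
  by apply: le_trans h; rewrite hS lerDr sumr_ge0// => k _; exact: sqr_ge0.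
have [->|S_neq0] := eqVneq S 0; first by rewrite sqr_ge0.
by rewrite expr2 ler_pM2r// lt_def S_neq0.
Qed.

(** Square summable rows: |A_ij x_j| <= |A_ij|^2 + |x_j|^2. *)
Lemma limit_series_cvg x i : in_l2 x -> cvgn [series A i j * x j]_j.
Proof.
move=> x2; pose v j := normc (A i j) ^+ 2 + normc (x j) ^+ 2.
apply: (@dominated_complex_series _ _ v (c ^+ 2 + limn [series normc (x k) ^+ 2]_k)).
  by move=> k; exact: normcM_le.
move=> n; rewrite big_split lerD ?limit_row_le//.
by apply: nneg_series_partial_le => // k; exact: sqr_ge0.
Qed.

Lemma limit_apply_l2 x : in_l2 x ->
  in_l2 (matrix_apply A x) /\ l2norm (matrix_apply A x) <= c * l2norm x.
Proof.
move=> x2; set L := limn [series normc (x k) ^+ 2]_k.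
have [//|n|cA lA] :=
    @nneg_series_bounded _ (fun i => normc (matrix_apply A x i) ^+ 2) (c ^+ 2 * L).
    by move=> k; exact: sqr_ge0.
  have cG : \sum_(i < n) normc (\sum_(j < m) A i j * x j) ^+ 2 @[m --> \oo] -->
      \sum_(i < n) normc (matrix_apply A x i) ^+ 2.
    apply: (@cvg_finsum _ _ (fun i m => normc (\sum_(j < m) A i j * x j) ^+ 2)
      (fun i => normc (matrix_apply A x i) ^+ 2)) => i _.
    apply: cvg_sqr; apply: cvg_normc.
    have := @limit_series_cvg x i x2; rewrite /matrix_apply.
    by under eq_cvg do rewrite seriesEord.
  rewrite -(cvg_lim _ cG)//; apply: limr_le; first by apply/cvg_ex; eexists; exact: cG.
  near=> m; apply: le_trans (limit_apply_le n m x) _.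
  rewrite ler_wpM2l ?sqr_ge0//; apply: nneg_series_partial_le => // k.
  exact: sqr_ge0.
split => //; rewrite /l2norm -[X in X * _](ger0_norm c0) -sqrtr_sqr -sqrtrM ?sqr_ge0//.
by rewrite ler_wsqrtr.
Unshelve. all: by end_near. Qed.

Lemma limit_defines_bounded_operator : defines_bounded_operator A.
Proof.
split=> [x x2|]; last by exists c => x /limit_apply_l2[].
by split=> [i|]; [exact: limit_series_cvg|have [] := limit_apply_l2 x2].
Qed.

Lemma in_l2_0 : in_l2 (fun=> 0 : Cfield R) /\ l2norm (fun=> 0 : Cfield R) = 0.
Proof.
have [|n|h1 h2] := @nneg_series_bounded _ (fun=> normc (0 : R[i]) ^+ 2) 0.
- by move=> _; exact: sqr_ge0.
- by rewrite big1// => i _; rewrite Normc.normc0 expr0n.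
by split=> //; apply/eqP; rewrite sqrtr_eq0.
Qed.

Lemma l2norm_ge0 (x : nat -> Cfield R) : 0 <= l2norm x.
Proof. exact: sqrtr_ge0. Qed.

Lemma l2norm_sqr (x : nat -> Cfield R) : in_l2 x ->
  l2norm x ^+ 2 = limn [series normc (x k) ^+ 2]_k.
Proof.
move=> x2; rewrite sqr_sqrtr//.
have x0 k : 0 <= normc (x k) ^+ 2 by exact: sqr_ge0.
by have := nneg_series_partial_le 0 x0 x2; rewrite big_ord0.
Qed.

Lemma operator_norm_has_sup : has_sup [set l2norm (matrix_apply A x) | x in
  [set x : nat -> Cfield R | in_l2 x /\ l2norm x <= 1]].
Proof.
split.
  have [h1 h2] := in_l2_0; exists (l2norm (matrix_apply A (fun=> 0))).
  by exists (fun=> 0) => //; split=> //; rewrite h2.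
exists c => _ [x [x2 x1] <-]; have [_ h] := limit_apply_l2 x2.
by apply: (le_trans h); rewrite ler_piMr.
Qed.

Lemma operator_norm_le : operator_norm A <= c.
Proof.
apply: ge_sup; first by case: operator_norm_has_sup.
move=> _ [x [x2 x1] <-]; have [_ h] := limit_apply_l2 x2.
by apply: (le_trans h); rewrite ler_piMr.
Qed.

Lemma l2_scale (x : nat -> Cfield R) (a : R) : in_l2 x -> 0 <= a ->
  in_l2 (fun k => (a%:C)%C * x k) /\ l2norm (fun k => (a%:C)%C * x k) = a * l2norm x.
Proof.
move=> x2 a0.
have aE : [series normc ((a%:C)%C * x k) ^+ 2]_k =
    (fun n => a ^+ 2 * [series normc (x k) ^+ 2]_k n).
  apply/funext => n; rewrite !seriesEord/= ?big_mkord mulr_sumr; apply: eq_bigr => k _.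
  by rewrite Normc.normcM exprMn /= expr0n addr0 sqrtr_sqr real_normK ?num_real.
have cE : [series normc ((a%:C)%C * x k) ^+ 2]_k @ \oo -->
    a ^+ 2 * limn [series normc (x k) ^+ 2]_k.
  by rewrite aE; apply: cvgMr; exact: x2.
split; first by apply/cvg_ex; eexists; exact: cE.
by rewrite /l2norm (cvg_lim _ cE)// sqrtrM ?sqr_ge0// sqrtr_sqr ger0_norm.
Qed.

(** The supremum runs over the unit ball only; homogeneity gives the other
    vectors. A vector of norm 0 has image of norm 0 by [limit_apply_l2]. *)
Lemma apply_le_operator_norm x : in_l2 x ->
  l2norm (matrix_apply A x) <= operator_norm A * l2norm x.
Proof.
move=> x2; have [Ax2 Axc] := limit_apply_l2 x2.
have [x0|x_neq0] := eqVneq (l2norm x) 0.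
  by move: Axc; rewrite x0 !mulr0.
have x_gt0 : 0 < l2norm x by rewrite lt_def x_neq0 l2norm_ge0.
pose a := (l2norm x)^-1; have a0 : 0 <= a by rewrite invr_ge0 ltW.
have [y2 yE] := l2_scale x2 a0.
have AyE : matrix_apply A (fun k => (a%:C)%C * x k) =
    (fun i => (a%:C)%C * matrix_apply A x i).
  apply/funext => i; apply/cvg_lim => //.
  rewrite (_ : [series _]_j = (fun n => (a%:C)%C * [series A i j * x j]_j n)).
    by apply: cvgMr; exact: limit_series_cvg.
  apply/funext => n; rewrite !seriesEord/= ?big_mkord mulr_sumr; apply: eq_bigr => k _.
  by rewrite mulrCA.
have [_ AyN] := l2_scale Ax2 a0.
have : l2norm (matrix_apply A (fun k => (a%:C)%C * x k)) <= operator_norm A.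
  apply: ub_le_sup; first by case: operator_norm_has_sup.
  by exists (fun k => (a%:C)%C * x k) => //; rewrite /= yE mulVf.
by rewrite AyE AyN mulrC ler_pdivrMr.
Qed.

Lemma operator_norm_ge0 : 0 <= operator_norm A.
Proof.
have [h1 h2] := in_l2_0.
apply: le_trans (l2norm_ge0 (matrix_apply A (fun=> 0))) _.
apply: ub_le_sup; first by case: operator_norm_has_sup.
by exists (fun=> 0) => //; split=> //; rewrite h2.
Qed.

(** Cauchy-Schwarz and [apply_le_operator_norm] for the vector with finitely many
    nonzero entries conj p_j, for which every series is a finite sum. *)
Lemma quadratic_le_operator_norm n (p : nat -> R[i]) :
  normc (\sum_(i < n) p i * \sum_(j < n) A i j * (p j)^*) <=
  operator_norm A * \sum_(i < n) normc (p i) ^+ 2.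
Proof.
pose x j : Cfield R := if (j < n)%N then (p j)^* else 0.
set S := \sum_(i < n) normc (p i) ^+ 2.
have S0 : 0 <= S by apply: sumr_ge0 => k _; exact: sqr_ge0.
have [|m|x2 xS] := @nneg_series_bounded _ (fun k => normc (x k) ^+ 2) S.
- by move=> k; exact: sqr_ge0.
- apply: (@le_trans _ _ (\sum_(k < maxn m n) normc (x k) ^+ 2)).
    apply: (@nneg_sum_le _ _ _ (fun k => normc (x k) ^+ 2)); last exact: leq_maxl.
    by move=> k; exact: sqr_ge0.
  rewrite (@sum_widen _ n _ (fun k => normc (x k) ^+ 2)) ?leq_maxr// => [|k nk].
    by apply: ler_sum => k _; rewrite /x ltn_ord normcJ.
  by rewrite /x ltnNge nk Normc.normc0 expr0n.
have AxE i : matrix_apply A x i = \sum_(j < n) A i j * (p j)^*.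
  apply/cvg_lim => //.
  apply: cvg_near_cst; exists n => // m /= nm.
  rewrite seriesEord/= (@sum_widen _ n _ (fun j => A i j * x j))// => [|k nk].
    by apply: eq_bigr => k _; rewrite /x ltn_ord.
  by rewrite /x ltnNge nk mulr0.
have [Ax2 _] := limit_apply_l2 x2.
have h := apply_le_operator_norm x2.
have opn0 := operator_norm_ge0.
have h' : \sum_(i < n) normc (matrix_apply A x i) ^+ 2 <= (operator_norm A) ^+ 2 * S.
  apply: (@le_trans _ _ (l2norm (matrix_apply A x) ^+ 2)).
    rewrite l2norm_sqr//.
    apply: (@nneg_series_partial_le _ (fun i => normc (matrix_apply A x i) ^+ 2)) => // k.
    exact: sqr_ge0.
  apply: (@le_trans _ _ ((operator_norm A * l2norm x) ^+ 2)).
    by rewrite ler_pXn2r// nnegrE ?mulr_ge0 ?l2norm_ge0.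
  by rewrite exprMn ler_wpM2l ?sqr_ge0// l2norm_sqr.
rewrite -(@ler_pXn2r _ 2)// ?nnegrE ?normc_ge0 ?mulr_ge0//.
under eq_bigr do rewrite -AxE.
have := cauchy_schwarz_sum n p (matrix_apply A x).
have nE (z : R[i]) : `|z| ^+ 2 = ((normc z ^+ 2)%:C)%C by rewrite rmorphXn.
rewrite nE; under [X in _ <= X * _ -> _]eq_bigr do rewrite nE.
under [X in _ <= _ * X -> _]eq_bigr do rewrite nE.
rewrite -!rmorph_sum -rmorphM lecR => /le_trans; apply.
rewrite exprMn [leRHS](_ : _ = S * (operator_norm A ^+ 2 * S)); last by ring.
by rewrite ler_wpM2l.
Qed.

End MatrixLimits.

(** * The Hermitian form of a measure *)

Section Moments.
Variable R : realType.
Implicit Types (f g : R * R -> R[i]).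

(** Measurability of complex functions is expressed through real and imaginary
    parts, as [cintegral] is. *)
Definition cmeasurable f :=
  measurable_fun setT (fun z => complex.Re (f z)) /\
  measurable_fun setT (fun z => complex.Im (f z)).

Lemma cmeasurable_toC : cmeasurable (@toC R).
Proof. by split; [exact: measurable_fst|exact: measurable_snd]. Qed.

Lemma cmeasurable_cst (a : R[i]) : cmeasurable (fun=> a).
Proof. by split; exact: measurable_cst. Qed.

Lemma cmeasurableD f g : cmeasurable f -> cmeasurable g ->
  cmeasurable (fun z => f z + g z).
Proof.
move=> [f1 f2] [g1 g2]; split.
  rewrite (_ : (fun _ => _) = (fun z => complex.Re (f z) + complex.Re (g z))).
    exact: measurable_funD.
  by apply/funext => z; case: (f z) (g z) => ? ? [].
rewrite (_ : (fun _ => _) = (fun z => complex.Im (f z) + complex.Im (g z))).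
  exact: measurable_funD.
by apply/funext => z; case: (f z) (g z) => ? ? [].
Qed.

Lemma cmeasurableM f g : cmeasurable f -> cmeasurable g ->
  cmeasurable (fun z => f z * g z).
Proof.
move=> [f1 f2] [g1 g2]; split.
  rewrite (_ : (fun _ => _) = (fun z => complex.Re (f z) * complex.Re (g z) -
    complex.Im (f z) * complex.Im (g z))).
    by apply: measurable_funB; exact: measurable_funM.
  by apply/funext => z; case: (f z) (g z) => ? ? [].
rewrite (_ : (fun _ => _) = (fun z => complex.Re (f z) * complex.Im (g z) +
    complex.Im (f z) * complex.Re (g z))).
  by apply: measurable_funD; exact: measurable_funM.
by apply/funext => z; case: (f z) (g z) => ? ? [].
Qed.

Lemma ReJ (z : R[i]) : complex.Re z^* = complex.Re z. Proof. by case: z. Qed.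

Lemma ImJ (z : R[i]) : complex.Im z^* = - complex.Im z. Proof. by case: z. Qed.

Lemma cmeasurableJ f : cmeasurable f -> cmeasurable (fun z => (f z)^*).
Proof.
move=> [f1 f2]; split; first by under eq_fun do rewrite ReJ.
by under eq_fun do rewrite ImJ; exact: measurable_funN.
Qed.

Lemma cmeasurable_horner (p : {poly R[i]}) : cmeasurable (fun z => p.[toC z]).
Proof.
elim/poly_ind: p => [|p c IHp].
  by under eq_fun do rewrite horner0; exact: cmeasurable_cst.
under eq_fun do rewrite hornerMXaddC.
apply: cmeasurableD; last exact: cmeasurable_cst.
by apply: cmeasurableM => //; exact: cmeasurable_toC.
Qed.

Lemma measurable_normc_sqr f : cmeasurable f ->
  measurable_fun setT (fun z => normc (f z) ^+ 2).
Proof.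
move=> [f1 f2]; under eq_fun do rewrite normc_sqr.
by apply: measurable_funD; exact: measurable_funX.
Qed.

Variable mu : {measure set (R * R) -> \bar R}.

Definition cintegrable f :=
  mu.-integrable setT (fun z => (complex.Re (f z))%:E) /\
  mu.-integrable setT (fun z => (complex.Im (f z))%:E).

Definition cint f : R[i] :=
  ((\int[mu]_z complex.Re (f z)) +i* (\int[mu]_z complex.Im (f z)))%C.

Lemma cintegrableP (f : R * R -> R[i]) (h : R * R -> R) : cmeasurable f ->
  (forall z, normc (f z) <= h z) -> mu.-integrable setT (EFin \o h) -> cintegrable f.
Proof.
move=> [f1 f2] fh ih; split.
  apply: le_integrable ih => //; first exact/measurable_EFinP.
  move=> z _; rewrite /= lee_fin (le_trans (Re_le_normc _))//.
  by rewrite (le_trans (fh z))// ler_norm.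
apply: le_integrable ih => //; first exact/measurable_EFinP.
move=> z _; rewrite /= lee_fin (le_trans (Im_le_normc _))//.
by rewrite (le_trans (fh z))// ler_norm.
Qed.

Lemma cintegrableD f g : cintegrable f -> cintegrable g ->
  cintegrable (fun z => f z + g z) /\ cint (fun z => f z + g z) = cint f + cint g.
Proof.
move=> [f1 f2] [g1 g2].
have eRe z : complex.Re (f z + g z) = complex.Re (f z) + complex.Re (g z).
  by case: (f z) (g z) => ? ? [].
have eIm z : complex.Im (f z + g z) = complex.Im (f z) + complex.Im (g z).
  by case: (f z) (g z) => ? ? [].
split.
  split; [under eq_fun do rewrite eRe|under eq_fun do rewrite eIm].
    exact: (integrableD _ f1 g1).
  exact: (integrableD _ f2 g2).
rewrite /cint; under eq_Rintegral do rewrite eRe.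
by under [X in (_ +i* X)%C]eq_Rintegral do rewrite eIm; rewrite !RintegralD.
Qed.

Lemma cintegrableZ (a : R[i]) f : cintegrable f ->
  cintegrable (fun z => a * f z) /\ cint (fun z => a * f z) = a * cint f.
Proof.
move=> [f1 f2]; case: a => a b.
have eRe z : complex.Re ((a +i* b)%C * f z) = a * complex.Re (f z) - b * complex.Im (f z).
  by case: (f z).
have eIm z : complex.Im ((a +i* b)%C * f z) = a * complex.Im (f z) + b * complex.Re (f z).
  by case: (f z).
split.
  split; [under eq_fun do rewrite eRe|under eq_fun do rewrite eIm].
    by apply: (integrableB _ (integrableZl _ a f1) (integrableZl _ b f2)).
  by apply: (integrableD _ (integrableZl _ a f2) (integrableZl _ b f1)).
rewrite /cint; under eq_Rintegral do rewrite eRe.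
under [X in (_ +i* X)%C]eq_Rintegral do rewrite eIm.
rewrite RintegralB ?RintegralD ?RintegralZl//.
all: try exact: (integrableZl _ _ f1).
all: exact: (integrableZl _ _ f2).
Qed.

Lemma cintJ f : cintegrable f ->
  cintegrable (fun z => (f z)^*) /\ cint (fun z => (f z)^*) = (cint f)^*.
Proof.
move=> [f1 f2]; split.
  split; [by under eq_fun do rewrite ReJ|under eq_fun do rewrite ImJ].
  exact: (integrableN f2).
rewrite /cint; under eq_Rintegral do rewrite ReJ.
under [X in (_ +i* X)%C]eq_Rintegral do rewrite ImJ -mulN1r.
by rewrite RintegralZl// mulN1r.
Qed.

Hypothesis mom : finite_moments mu.

Lemma cintegrable_monomial (i j : nat) :
  cintegrable (fun z => toC z ^+ i * ((toC z)^*) ^+ j).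
Proof.
apply: (@cintegrableP _ (fun z => normc (toC z) ^+ (i + j))).
- apply: cmeasurableM.
    by under eq_fun do rewrite -hornerXn; exact: cmeasurable_horner.
  under eq_fun do rewrite -rmorphXn -hornerXn.
  by apply: cmeasurableJ; exact: cmeasurable_horner.
- move=> z; rewrite Normc.normcM.
  by rewrite !normcX normcJ exprD.
- exact: mom.
Qed.

Lemma cintegrable_sum n (F : nat -> R * R -> R[i]) :
  (forall k, cintegrable (F k)) -> cintegrable (fun z => \sum_(k < n) F k z).
Proof.
move=> Fi; elim: n => [|n IHn].
  under eq_fun do rewrite big_ord0.
  by split; exact: (integrable0 mu).
under eq_fun do rewrite big_ord_recr/=.
by have [] := cintegrableD IHn (Fi n).
Qed.

(** Expand both factors into monomials, which the moments dominate. *)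
Lemma cintegrable_poly (p q : {poly R[i]}) :
  cintegrable (fun z => p.[toC z] * (q.[toC z])^*).
Proof.
have E z : p.[toC z] * (q.[toC z])^* =
    \sum_(i < size p) \sum_(j < size q)
      (p`_i * (q`_j)^*) * (toC z ^+ i * ((toC z)^*) ^+ j).
  rewrite !horner_coef rmorph_sum mulr_suml; apply: eq_bigr => i _.
  rewrite mulr_sumr; apply: eq_bigr => j _ /=.
  by rewrite rmorphM rmorphXn /= mulrACA.
under eq_fun do rewrite E.
apply: (cintegrable_sum _ (F := fun i z => \sum_(j < size q)
      (p`_i * (q`_j)^*) * (toC z ^+ i * ((toC z)^*) ^+ j))) => i.
apply: (cintegrable_sum _ (F := fun j z =>
      (p`_i * (q`_j)^*) * (toC z ^+ i * ((toC z)^*) ^+ j))) => j.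
by have [] := cintegrableZ (p`_i * (q`_j)^*) (cintegrable_monomial i j).
Qed.

(** The form <p, q> of L2(mu), restricted to polynomials. *)
Definition pform (p q : {poly R[i]}) : R[i] :=
  cint (fun z => p.[toC z] * (q.[toC z])^*).

Lemma pformP a p q r : pform (a *: p + q) r = a * pform p r + pform q r.
Proof.
have [h1 h2] := cintegrableZ a (cintegrable_poly p r).
have [_ h3] := cintegrableD h1 (cintegrable_poly q r).
rewrite /pform -h2 -h3; congr cint; apply/funext => z.
by rewrite hornerD hornerZ mulrDl mulrA.
Qed.

Lemma pformJ p q : pform q p = (pform p q)^*.
Proof.
have [_ <-] := cintJ (cintegrable_poly p q).
by congr cint; apply/funext => z; rewrite rmorphM /= conjCK mulrC.
Qed.

Definition energy (p : {poly R[i]}) : R := \int[mu]_z normc p.[toC z] ^+ 2.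

Lemma sqr_normcE (z : R[i]) : z * z^* = ((normc z ^+ 2)%:C)%C.
Proof. by rewrite -normCK rmorphXn. Qed.

Lemma pform_energy p : pform p p = ((energy p)%:C)%C.
Proof.
rewrite /pform /cint; under eq_Rintegral do rewrite sqr_normcE/=.
under [X in (_ +i* X)%C]eq_Rintegral do rewrite sqr_normcE/=.
by congr (_ +i* _)%C; rewrite Rintegral_cst ?mul0r.
Qed.

Lemma integrable_normc_sqr (p : {poly R[i]}) :
  mu.-integrable setT (fun z => (normc p.[toC z] ^+ 2)%:E).
Proof.
have [+ _] := cintegrable_poly p p.
by under eq_fun do rewrite sqr_normcE/=.
Qed.

Lemma energy_ge0 p : 0 <= energy p.
Proof. by apply: Rintegral_ge0 => z _; exact: sqr_ge0. Qed.

Lemma EFin_energy p : (energy p)%:E = (\int[mu]_z (normc p.[toC z] ^+ 2)%:E)%E.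
Proof.
by rewrite /energy /Rintegral fineK//; exact: (integrable_fin_num _ (integrable_normc_sqr p)).
Qed.

Lemma pform_moment (i j : nat) : pform 'X^i 'X^j = moment mu i j.
Proof.
by congr cint; apply/funext => z; rewrite !hornerXn rmorphXn.
Qed.

End Moments.

(** * The matrix A as a family of best constants *)

Definition coef_bound (R : realType) (mu : {measure set (R * R) -> \bar R})
    (n : nat) (c : R) : Prop :=
  forall p : {poly R[i]}, \sum_(i < n) normc p`_i ^+ 2 <= c * energy mu p.

Section InverseMatrix.
Variables (R : realType) (mu : {measure set (R * R) -> \bar R}).
Hypothesis mom : finite_moments mu.
Variable c : R.
Hypothesis c0 : 0 <= c.
Hypothesis mu_c : forall n, coef_bound mu n c.

Let P := orthonormal_polynomials mu.

(** A polynomial of energy 0 has only null coefficients, by the bound of order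
    size p. *)
Lemma pform_gt0 (p : {poly R[i]}) : p != 0 -> 0 < pform mu p p.
Proof.
move=> p0; rewrite pform_energy ltcR lt_def energy_ge0 andbT.
apply/negP => /eqP e0; move/negP: p0; apply; apply/eqP.
have := mu_c (size p) p; rewrite e0 mulr0 => h.
have : \sum_(i < size p) normc p`_i ^+ 2 = 0.
  by apply/eqP; rewrite eq_le h sumr_ge0// => k _; exact: sqr_ge0.
move=> /psumr_eq0P h0; apply/polyP => i; rewrite coef0.
have [lti|/(nth_default 0)//] := ltnP i (size p).
have /eqP := h0 (fun k _ => sqr_ge0 _) (Ordinal lti) isT.
by rewrite sqrf_eq0 => /eqP/Normc.eq0_normc.
Qed.

Lemma orthonormal_polynomialsP : is_orthonormal_sequence mu P.
Proof.
apply: xgetPex; have [Q [Q1 Q2]] := gram_schmidt (pformP mom) (pformJ mom) pform_gt0.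
by exists Q.
Qed.

Let sP n : size (P n) = n.+1. Proof. by have [/(_ n)[]] := orthonormal_polynomialsP. Qed.
Let oP m n : pform mu (P m) (P n) = (m == n)%:R.
Proof. by have [_] := orthonormal_polynomialsP; exact. Qed.

(** The terms with k < max i j that the partial sum omits vanish, because P_k has
    degree k. *)
Lemma A_partialE i j N : A_partial mu i j N = gram_inv P N i j :> R[i].
Proof.
rewrite /A_partial /gram_inv -(big_mkord xpredT (fun k => ((P k)`_i)^* * (P k)`_j)).
have z k : (k < maxn i j)%N -> ((P k)`_i)^* * (P k)`_j = 0.
  rewrite leq_max => /orP[ki|kj].
    by rewrite (@nth_default _ _ (P k) i) ?sP// rmorph0 mul0r.
  by rewrite (@nth_default _ _ (P k) j) ?sP// mulr0.
have [mN|Nm] := leqP (maxn i j) N.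
  rewrite [RHS](big_cat_nat (leq0n _) mN)/= [X in _ = X + _]big_nat_cond.
  by rewrite [X in _ = X + _]big1 ?add0r// => k; rewrite andbT => /andP[_ /z].
rewrite [LHS]big_geq ?(ltnW Nm)// [RHS]big_nat_cond [RHS]big1// => k; rewrite andbT => /andP[_ kN].
exact: z (ltn_trans kN Nm).
Qed.

Let b i k := (P k)`_i.

Let AE i j : A_partial mu i j = (fun N => \sum_(k < N) ((b i k)^* * b j k)%C : Cfield R).
Proof. by apply/funext => N; exact: A_partialE. Qed.

Lemma real_norm_sum n (x : nat -> R[i]) :
  \sum_(i < n) `|x i| ^+ 2 = ((\sum_(i < n) normc (x i) ^+ 2)%:C)%C.
Proof. by rewrite rmorph_sum; apply: eq_bigr => i _; rewrite rmorphXn. Qed.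

Lemma complex_coef_bound n d : coef_bound mu n d ->
  forall p : {poly R[i]}, \sum_(i < n) `|p`_i| ^+ 2 <= (d%:C)%C * pform mu p p.
Proof.
by move=> h p; rewrite (real_norm_sum n (fun i => p`_i)) pform_energy -rmorphM lecR.
Qed.

Let diag_le i N : \sum_(k < N) normc (b i k) ^+ 2 <= c.
Proof.
have cc0 : 0 <= (c%:C)%C by rewrite lecR.
have := gram_inv_diag_le (pformP mom) (pformJ mom) oP N cc0 (ltnSn i)
  (complex_coef_bound (mu_c i.+1)).
by rewrite (real_norm_sum N (fun k => (P k)`_i)) lecR.
Qed.

Let apply_le N I m (x : nat -> R[i]) :
  \sum_(i < I) normc (\sum_(j < m) (\sum_(k < N) ((b i k)^* * b j k)%C) * x j) ^+ 2 <=
  c ^+ 2 * \sum_(j < m) normc (x j) ^+ 2.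
Proof.
have cc0 : 0 <= (c%:C)%C by rewrite lecR.
have := gram_inv_apply_le (pformP mom) (pformJ mom) oP N I m x cc0
  (fun n => complex_coef_bound (mu_c n)).
rewrite (real_norm_sum I (fun i => \sum_(j < m) gram_inv P N i j * x j)).
by rewrite (real_norm_sum m x) -rmorphXn -rmorphM lecR.
Qed.

Let A_matrixE : A_matrix mu =
  fun i j => limn (fun N => \sum_(k < N) ((b i k)^* * b j k)%C : Cfield R).
Proof. by apply/funext => i; apply/funext => j; rewrite /A_matrix AE. Qed.

Lemma A_partial_cvg i j : cvgn (A_partial mu i j).
Proof. by rewrite AE; exact: gram_inv_cvg diag_le i j. Qed.

Lemma coef_bound_A_operator_exists : A_operator_exists mu.
Proof.
split; [|exact: A_partial_cvg|].
  move=> n; have := det_gram_gt0 (pformP mom) (pformJ mom) sP oP n.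
  congr (_ < \det _); apply/matrixP => i j; rewrite !mxE; exact: pform_moment.
by rewrite A_matrixE; exact: limit_defines_bounded_operator c0 diag_le apply_le.
Qed.

Lemma operator_norm_A_le : operator_norm (A_matrix mu) <= c.
Proof. by rewrite A_matrixE; exact: operator_norm_le c0 diag_le apply_le. Qed.

Lemma operator_norm_A_ge0 : 0 <= operator_norm (A_matrix mu).
Proof. by rewrite A_matrixE; exact: operator_norm_ge0 c0 diag_le apply_le. Qed.

(** Let N tend to infinity in [norm_le_gram_inv] and use
    [quadratic_le_operator_norm]: with S the sum of all the |p_i|^2 and a the norm,
    S^2 <= Q(p) a S. *)
Lemma coef_bound_operator_norm n : coef_bound mu n (operator_norm (A_matrix mu)).
Proof.
move=> p; pose m := maxn n (size p); set S := \sum_(i < n) _.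
pose S' := \sum_(i < m) normc p`_i ^+ 2.
have SS' : S <= S'.
  apply: (@nneg_sum_le _ _ _ (fun k => normc p`_k ^+ 2)); last exact: leq_maxl.
  by move=> k; exact: sqr_ge0.
apply: (le_trans SS'); set a := operator_norm _.
have S'0 : 0 <= S' by apply: sumr_ge0 => k _; exact: sqr_ge0.
have e0 := energy_ge0 mu p.
have a0 : 0 <= a := operator_norm_A_ge0.
have [->|S'n] := eqVneq S' 0; first by rewrite mulr_ge0.
have S'gt0 : 0 < S' by rewrite lt_def S'n.
suff : S' ^+ 2 <= energy mu p * (a * S').
  by rewrite mulrA [_ * a]mulrC expr2 ler_pM2r.
pose T N : R[i] := \sum_(i < m) p`_i * \sum_(j < m) A_partial mu i j N * (p`_j)^*.
pose T' : R[i] := \sum_(i < m) p`_i * \sum_(j < m) A_matrix mu i j * (p`_j)^*.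
have TT' : (T N : Cfield R) @[N --> \oo] --> (T' : Cfield R).
  apply: (@cvg_finsum (Cfield R) m (fun i N => p`_i * \sum_(j < m) A_partial mu i j N * (p`_j)^*)
    (fun i => p`_i * \sum_(j < m) A_matrix mu i j * (p`_j)^*)) => i _.
  apply: cvgMr.
  apply: (@cvg_finsum (Cfield R) m (fun j N => A_partial mu i j N * (p`_j)^*)
    (fun j => A_matrix mu i j * (p`_j)^*)) => j _.
  by apply: cvgMl; exact: A_partial_cvg.
have hN N : (size p <= N)%N -> S' ^+ 2 <= energy mu p * normc (T N).
  move=> sN; have := norm_le_gram_inv (pformP mom) (pformJ mom) sP oP m sN.
  rewrite (real_norm_sum m (fun i => p`_i)) pform_energy -/S' => h.
  have hT : \sum_(i < m) p`_i * (\sum_(j < m) gram_inv P N i j * (p`_j)^*) = T N.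
    by apply: eq_bigr => i _; congr (_ * _); apply: eq_bigr => j _; rewrite A_partialE.
  rewrite hT in h.
  have S0 : 0 <= ((S' ^+ 2)%:C)%C :> R[i] by rewrite lecR sqr_ge0.
  rewrite -rmorphXn in h.
  have hn := ger0_norm (le_trans S0 h).
  rewrite -{}hn in h.
  have nE (z : R[i]) : `|z| = ((normc z)%:C)%C by [].
  by move: h; rewrite nE lecR Normc.normcM /= expr0n addr0 sqrtr_sqr ger0_norm.
have T'le : normc T' <= a * S'.
  have := quadratic_le_operator_norm c0 diag_le apply_le m (fun i => p`_i).
  by rewrite /T' /a A_matrixE.
apply: le_trans (ler_wpM2l e0 T'le).
have cT := cvg_normc TT'.
have cT2 : energy mu p * normc (T N) @[N --> \oo] --> energy mu p * normc T' by exact: cvgMr.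
rewrite -(cvg_lim _ cT2)//; apply: limr_ge; first by apply/cvg_ex; eexists; exact: cT2.
by near=> N; apply: hN; near: N; exact: nbhs_infty_ge.
Unshelve. all: by end_near. Qed.

Let cA00 : normc (A_partial mu 0 0 N) @[N --> \oo] --> normc (A_matrix mu 0 0).
Proof. by apply: cvg_normc; exact: A_partial_cvg. Qed.

Let A_partial00 N : A_partial mu 0 0 N = ((\sum_(k < N) normc (b 0 k) ^+ 2)%:C)%C :> R[i].
Proof.
rewrite A_partialE -(real_norm_sum N (fun k => b 0 k)).
by apply: eq_bigr => k _; rewrite normCKC.
Qed.

Let normA_partial00 N : normc (A_partial mu 0 0 N) = \sum_(k < N) normc (b 0 k) ^+ 2.
Proof.
rewrite A_partial00 /= expr0n addr0 sqrtr_sqr ger0_norm// sumr_ge0// => k _.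
exact: sqr_ge0.
Qed.

(** Needed because A[0,0] lives in R[i], whereas bounds are real; its partial sums
    are sums of squared moduli. *)
Lemma A00_real : A_matrix mu 0 0 = ((normc (A_matrix mu 0 0))%:C)%C.
Proof.
apply/cvg_lim => //; apply: cvg_complex.
  rewrite (_ : (fun _ => _) = fun N => normc (A_partial mu 0 0 N))//.
  apply/funext => N; rewrite normA_partial00.
  by rewrite -[X in complex.Re X]/(A_partial mu 0 0 N) A_partial00.
rewrite (_ : (fun _ => _) = cst 0); first exact: cvg_cst.
by apply/funext => N; rewrite -[X in complex.Im X]/(A_partial mu 0 0 N) A_partial00.
Qed.

Lemma A00_le d : 0 <= d -> coef_bound mu 1 d -> normc (A_matrix mu 0 0) <= d.
Proof.
move=> d0 hd; rewrite -(cvg_lim _ cA00)//.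
apply: limr_le; first by apply/cvg_ex; eexists; exact: cA00.
near=> N; rewrite normA_partial00.
have cd0 : 0 <= (d%:C)%C by rewrite lecR.
have := gram_inv_diag_le (pformP mom) (pformJ mom) oP N cd0 (ltnSn 0) (complex_coef_bound hd).
by rewrite (real_norm_sum N (fun k => (P k)`_0)) lecR.
Unshelve. all: by end_near. Qed.

Lemma coef_bound_A00 : coef_bound mu 1 (normc (A_matrix mu 0 0)).
Proof.
move=> p; rewrite big_ord_recr big_ord0 /= add0r mulrC.
have cT2 : energy mu p * normc (A_partial mu 0 0 N) @[N --> \oo] -->
  energy mu p * normc (A_matrix mu 0 0) by exact: cvgMr.
rewrite -(cvg_lim _ cT2)//; apply: limr_ge; first by apply/cvg_ex; eexists; exact: cT2.
near=> N; have sN : (size p <= N)%N by near: N; exact: nbhs_infty_ge.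
rewrite normA_partial00.
have := coef_le_gram_inv (pformP mom) (pformJ mom) sP oP 0 (leqnn _) sN.
rewrite -A_partialE A_partial00 pform_energy -rmorphM.
by rewrite -[`|_|]/((normc _)%:C)%C -rmorphXn lecR.
Unshelve. all: by end_near. Qed.

End InverseMatrix.

(** * The smallest eigenvalues *)

Section SmallestEigenvalue.
Variables (R : realType) (mu : {measure set (R * R) -> \bar R}).
Hypothesis mom : finite_moments mu.
Local Open Scope sesquilinear_scope.

Lemma quadratic_form_section n (v : 'rV[R[i]]_n.+1) :
  (v *m moment_section mu n *m v ^t*) 0 0 =
  ((energy mu (\sum_(i < n.+1) v 0 i *: 'X^i))%:C)%C.
Proof.
pose x k := v 0 (inord k).
have -> : \sum_(i < n.+1) v 0 i *: 'X^i = \sum_(i < n.+1) x i *: 'X^i.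
  by apply: eq_bigr => i _; rewrite /x inord_val.
rewrite -pform_energy (form_sumr (pformP mom) (pformJ mom) _ (fun i => x i *: 'X^i)) mxE.
apply: eq_bigr => j _.
rewrite (formZr (pformP mom) (pformJ mom)) (form_suml (pformP mom) _ (fun i => x i *: 'X^i)).
rewrite !mxE mulrC /x inord_val; congr (_ * _).
apply: eq_bigr => i _; rewrite (formZl (pformP mom)) pform_moment mxE.
by rewrite inord_val.
Qed.

Lemma moment_section_hermitian n : moment_section mu n \is hermsymmx.
Proof.
apply/is_hermitianmxP; rewrite expr0 scale1r; apply/matrixP => i j.
by rewrite !mxE -!pform_moment pformJ.
Qed.

Lemma row_dot n (v : 'rV[R[i]]_n) :
  (v *m v ^t*) 0 0 = ((\sum_i normc (v 0 i) ^+ 2)%:C)%C.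
Proof.
rewrite mxE rmorph_sum; apply: eq_bigr => i _.
by rewrite !mxE sqr_normcE.
Qed.

(** The infimum is that of a set bounded below: an eigenvector v of eigenvalue y
    gives y |v|^2 = Q(p) >= 0 for the polynomial p with coefficients v. *)
Lemma smallest_eigenvalue_le n (x : R) :
  eigenvalue (moment_section mu n) (x%:C)%C -> smallest_eigenvalue mu n <= x.
Proof.
move=> ex; apply: ge_inf => //; exists 0 => y /= /eigenvalueP[v vM v0].
have := quadratic_form_section v; rewrite vM -scalemxAl mxE row_dot -rmorphM => -[yE].
have s0 : 0 < \sum_i normc (v 0 i) ^+ 2.
  rewrite lt_def sumr_ge0 ?andbT => [|k _]; last exact: sqr_ge0.
  apply/negP => /eqP/psumr_eq0P h; move/negP: v0; apply; apply/eqP/rowP => i.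
  have /eqP := h (fun k _ => sqr_ge0 _) i isT.
  by rewrite sqrf_eq0 mxE => /eqP/Normc.eq0_normc.
by rewrite -(pmulr_lge0 _ s0) yE energy_ge0.
Qed.

(** Diagonalize the section in a unitary basis: its diagonal entries are real
    eigenvalues, hence at least the smallest one. *)
Lemma smallest_eigenvalue_rayleigh n (v : 'rV[R[i]]_n.+1) :
  smallest_eigenvalue mu n * \sum_i normc (v 0 i) ^+ 2 <=
  energy mu (\sum_(i < n.+1) v 0 i *: 'X^i).
Proof.
have herm := moment_section_hermitian n.
set M := moment_section mu n in herm *.
have /orthomx_spectralP ME := hermitian_normalmx herm.
set P := spectralmx M in ME; set D := spectral_diag M in ME.
have Pu : P \is unitarymx := spectral_unitarymx M.
have Pun := unitarymx_unit Pu.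
have Dreal i : D 0 i = ((complex.Re (D 0 i))%:C)%C.
  by have /mxOverP/(_ 0 i)/RRe_real := hermitian_spectral_diag_real herm.
have Deig i : eigenvalue M ((complex.Re (D 0 i))%:C)%C.
  rewrite -Dreal; apply/eigenvalueP; exists (row i P).
    rewrite -row_mul ME !mulmxA mulmxV// mul1mx row_mul row_diag_mx.
    by rewrite -scalemxAl -rowE.
  apply/negP => /eqP r0; have := mulmxV Pun => /(congr1 (row i)).
  rewrite row_mul r0 mul0mx => /rowP/(_ i)/eqP; rewrite !mxE eqxx eq_sym.
  by rewrite oner_eq0.
(* coordinates of v in the eigenbasis *)
pose w := v *m P ^t*.
have iP : invmx P = P ^t* by rewrite invmx_unitary.
have ww : w *m w ^t* = v *m v ^t*.
  by rewrite /w trmx_mul map_mxM trmxCK mulmxA -iP mulmxKV.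
have vMv : v *m M *m v ^t* = w *m diag_mx D *m w ^t*.
  by rewrite ME /w trmx_mul map_mxM trmxCK iP !mulmxA.
rewrite -lecR -quadratic_form_section -/M vMv rmorphM /= -(row_dot v) -ww.
have -> : (w *m diag_mx D *m w ^t*) 0 0 = \sum_i D 0 i * ((normc (w 0 i) ^+ 2)%:C)%C.
  rewrite mul_mx_diag mxE; apply: eq_bigr => i _; rewrite !mxE.
  by rewrite mulrAC sqr_normcE mulrC.
rewrite row_dot rmorph_sum mulr_sumr; apply: ler_sum => i _.
rewrite Dreal -!rmorphM lecR ler_wpM2r ?sqr_ge0//.
exact: smallest_eigenvalue_le.
Qed.

(** The limit of a divergent sequence is 0, so a positive value means
    convergence to some L > 0. Eventually the smallest eigenvalue exceeds L / 2; a
    polynomial of low degree may be seen as one of high degree. *)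
Lemma coef_bound_of_limn : 0 < limn (smallest_eigenvalue mu) ->
  exists2 c : R, 0 <= c & forall n, coef_bound mu n c.
Proof.
set L := limn _ => L0.
have cL : cvgn (smallest_eigenvalue mu).
  by apply: contrapT => /dvgP h; move: L0; rewrite /L h ltxx.
have [N _ NP] : \forall n \near \oo, L / 2 < smallest_eigenvalue mu n.
  by apply: (cvgr_gt _ cL); rewrite -/L ltr_pdivrMr// ltr_pMr// ltr1n.
exists (2 / L) => [|n p]; first by rewrite divr_ge0 ?ltW.
(* A section beyond N that sees all the coefficients of p and the first n ones. *)
pose m := maxn N (maxn n (size p)).
have := smallest_eigenvalue_rayleigh (\row_(i < m.+1) p`_i).
have -> : \sum_(i < m.+1) (\row_(i < m.+1) p`_i) 0 i *: 'X^i = p.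
  under eq_bigr do rewrite mxE; rewrite -poly_def; apply/polyP => i.
  rewrite coef_poly; case: ltnP => // mi; rewrite nth_default//.
  by rewrite (leq_trans _ (ltnW mi))// /m !leq_max leqnn !orbT.
under eq_bigr do rewrite mxE.
set S := \sum_(i < m.+1) _ => h.
have SnS : \sum_(i < n) normc p`_i ^+ 2 <= S.
  have nm : (n <= m.+1)%N by rewrite leqW// /m !leq_max leqnn !orbT.
  apply: (@nneg_sum_le _ _ _ (fun k => normc p`_k ^+ 2)) => // k.
  exact: sqr_ge0.
have S0 : 0 <= S by apply: sumr_ge0 => k _; exact: sqr_ge0.
have lm : L / 2 < smallest_eigenvalue mu m by apply: NP; rewrite /= /m leq_maxl.
apply: (le_trans SnS); rewrite -[2 / L]invf_div ler_pdivlMl ?divr_gt0//.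
by apply: le_trans h; rewrite ler_wpM2r// ltW.
Qed.

End SmallestEigenvalue.

(** * Polynomials on the unit circle *)

Section Circle.
Variable R : realType.
Implicit Types (p q f g h s : {poly R[i]}).

(** By [discrete_parseval], the squared norm of p in L2 of the circle with
    normalized arc length. *)
Definition l2sq p : R := \sum_(i < size p) normc p`_i ^+ 2.

Lemma l2sqE p n : (size p <= n)%N -> \sum_(i < n) normc p`_i ^+ 2 = l2sq p.
Proof.
move=> sn; apply: (@sum_widen _ _ _ (fun k => normc p`_k ^+ 2)) => // k sk.
by rewrite nth_default// Normc.normc0 expr0n.
Qed.

Lemma coef_sum_le_l2sq n p : \sum_(i < n) normc p`_i ^+ 2 <= l2sq p.
Proof.
rewrite -(l2sqE (leq_maxr n (size p))).
apply: (@nneg_sum_le _ _ _ (fun k => normc p`_k ^+ 2)); last exact: leq_maxl.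
by move=> k; exact: sqr_ge0.
Qed.

Lemma l2sq_ge0 p : 0 <= l2sq p.
Proof. by apply: sumr_ge0 => k _; exact: sqr_ge0. Qed.

Definition expi (t : R) : R[i] := (cos t +i* sin t)%C.

Lemma expiD t u : expi (t + u) = expi t * expi u.
Proof. by rewrite /expi cosD sinD; congr (_ +i* _)%C; rewrite addrC mulrC [X in _ + X]mulrC. Qed.

Lemma expi0 : expi 0 = 1.
Proof. by rewrite /expi cos0 sin0. Qed.

Lemma expiX t k : expi t ^+ k = expi (k%:R * t).
Proof.
elim: k => [|k IHk]; first by rewrite mul0r expi0.
by rewrite exprS IHk -expiD -natr1 mulrDl mul1r addrC.
Qed.

Lemma normc_expi t : normc (expi t) = 1.
Proof. by rewrite /= cos2Dsin2 sqrtr1. Qed.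

Lemma conj_expi t : (expi t)^* = expi (- t).
Proof. by rewrite /expi cosN sinN. Qed.

Lemma expi_neq1 t : 0 < t < pi *+ 2 -> expi t != 1.
Proof.
move=> /andP[t0 tpi]; apply/eqP => -[ct _].
have : 0 < sin (t / 2).
  by rewrite sin_gt0_pi// divr_gt0//= ltr_pdivrMr// mulr_natr.
have tE : t = (t / 2) *+ 2 by rewrite -mulr_natr divfK.
rewrite tE cos_mulr2n cos2sin2 in ct.
have /eqP : sin (t / 2) ^+ 2 = 0 by lra.
by rewrite sqrf_eq0 => /eqP ->; rewrite ltxx.
Qed.

(** A geometric sum whose ratio u is an n-th root of unity distinct from 1. *)
Lemma sum_roots n k : (0 < k < n)%N ->
  \sum_(j < n) expi ((pi *+ 2) / n%:R * k%:R) ^+ j = 0.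
Proof.
move=> /andP[k0 kn]; have n0 : (0 : R) < n%:R by rewrite ltr0n (ltn_trans k0).
set u := expi _.
have un : u ^+ n = 1.
  rewrite /u expiX mulrA mulrCA mulfV ?gt_eqF// mulr1 -[_ *+ 2 * _]mulrC -expiX.
  have -> : expi (pi *+ 2) = 1 by rewrite /expi cos2pi sin2pi.
  by rewrite expr1n.
have u1 : u != 1.
  have pi2 : (0 : R) < pi *+ 2 by rewrite pmulrn_lgt0// pi_gt0.
  have kR : (0 : R) < k%:R by rewrite ltr0n.
  apply: expi_neq1; rewrite mulrAC (divr_gt0 (mulr_gt0 pi2 kR) n0)/=.
  by rewrite ltr_pdivrMr// (ltr_pM2l pi2) ltr_nat.
have := subrX1 u n; rewrite un subrr => /esym/eqP.
by rewrite mulf_eq0 subr_eq0 (negPf u1) => /eqP.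
Qed.

(** Averaging over the n-th roots of unity is exact for polynomials of size at most
    n, and dispenses with integrals of trigonometric functions. *)
Lemma discrete_parseval n f : (size f <= n)%N -> (0 < n)%N ->
  \sum_(j < n) normc f.[expi ((pi *+ 2) / n%:R * j%:R)] ^+ 2 = n%:R * l2sq f.
Proof.
move=> sf n0; set th := (pi *+ 2) / n%:R.
(* The identity in R[i], where |w|^2 is a product. *)
have key : \sum_(j < n) f.[expi (th * j%:R)] * (f.[expi (th * j%:R)])^* =
    n%:R * \sum_(a < n) f`_a * (f`_a)^*.
  have E (j : 'I_n) : f.[expi (th * j%:R)] * (f.[expi (th * j%:R)])^* =
      \sum_(a < n) \sum_(b < n) (f`_a * (f`_b)^*) *
        (expi (th * a%:R) * (expi (th * b%:R))^*) ^+ j.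
    rewrite (horner_coef_wide _ sf) rmorph_sum mulr_suml; apply: eq_bigr => a _.
    rewrite mulr_sumr; apply: eq_bigr => b _ /=.
    rewrite rmorphM rmorphXn /= mulrACA exprMn !conj_expi !expiX.
    by congr (_ * (expi _ * expi _)); ring.
  under eq_bigr do rewrite E.
  rewrite exchange_big/= mulr_sumr; apply: eq_bigr => a _.
  rewrite exchange_big/= (bigD1 a)//= [X in _ + X]big1 ?addr0 => [|b ba].
    rewrite -mulr_sumr conj_expi -expiD subrr expi0.
    by under eq_bigr do rewrite expr1n; rewrite sumr_const card_ord mulrC.
  rewrite -mulr_sumr [X in _ * X](_ : _ = 0) ?mulr0//.
  have [ab|ba'] := ltnP a b.
    apply: (inv_inj conjCK); rewrite rmorph0 rmorph_sum.
    rewrite -[RHS](@sum_roots n (b - a)).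
      apply: eq_bigr => j _; rewrite rmorphXn rmorphM /= conjCK conj_expi -expiD.
      by rewrite natrB ?(ltnW ab)//; congr (expi _ ^+ _); rewrite -/th; ring.
    by rewrite subn_gt0 ab/= (leq_ltn_trans (leq_subr _ _)).
  have {}ba : (b < a)%N by rewrite ltn_neqAle ba' andbT.
  rewrite -[RHS](@sum_roots n (a - b)).
    apply: eq_bigr => j _; rewrite conj_expi -expiD.
    by rewrite natrB ?(ltnW ba)//; congr (expi _ ^+ _); rewrite -/th; ring.
  by rewrite subn_gt0 ba/= (leq_ltn_trans (leq_subr _ _)).
apply: (@complexI R); rewrite -(l2sqE sf) rmorphM !rmorph_sum rmorph_nat /=.
under eq_bigr do rewrite -sqr_normcE.
by under [in RHS]eq_bigr do rewrite -sqr_normcE.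
Qed.

(** Parseval at roots of unity of large order turns a pointwise inequality on the
    circle into one between sums of squared coefficients. *)
Lemma l2sq_le_circle f g (K : R) :
  (forall z, normc z = 1 -> normc f.[z] ^+ 2 <= K * normc g.[z] ^+ 2) ->
  l2sq f <= K * l2sq g.
Proof.
move=> fg; pose n := (maxn (size f) (size g)).+1.
have sf : (size f <= n)%N by rewrite leqW// leq_maxl.
have sg : (size g <= n)%N by rewrite leqW// leq_maxr.
have n0 : (0 : R) < n%:R by rewrite ltr0n.
rewrite -(ler_pM2l n0) mulrCA -!discrete_parseval// mulr_sumr.
by apply: ler_sum => j _; apply: fg; exact: normc_expi.
Qed.

Definition coef_norm1 p : R := \sum_(i < size p) normc p`_i.

Lemma coef_norm1_ge0 p : 0 <= coef_norm1 p.
Proof. by apply: sumr_ge0 => k _; exact: normc_ge0. Qed.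

Lemma horner_le_norm1 p z : normc z = 1 -> normc p.[z] <= coef_norm1 p.
Proof.
move=> z1; rewrite horner_coef /coef_norm1.
elim/big_rec2: _ => [|i x y _ h]; first by rewrite Normc.normc0.
apply: (le_trans (le_normcD _ _)); rewrite lerD// Normc.normcM normcX z1 expr1n.
by rewrite mulr1.
Qed.

(** Induction on s, written c + X s: on the circle
    |c + z s|^2 = |c|^2 + |s|^2 + 2 Re (conj c z s), and the last term is the real
    part of a polynomial vanishing at 0. *)
Lemma analytic_completion s : exists2 h : {poly R[i]}, h`_0 = ((l2sq s)%:C)%C &
  forall z, normc z = 1 -> complex.Re h.[z] = normc s.[z] ^+ 2.
Proof.
elim/poly_ind: s => [|s c [h h0 hz]].
  exists 0; first by rewrite coef0 /l2sq size_poly0 big_ord0.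
  by move=> z _; rewrite !horner0 Normc.normc0 expr0n.
exists (h + ((normc c ^+ 2)%:C)%C%:P + (2 * c^*) *: (s * 'X)).
  rewrite !coefD coefC coefZ coefMX mulr0 addr0 h0 -rmorphD; congr (_%:C)%C.
  have sz : (size (s * 'X + c%:P)%R <= (size s).+1)%N.
    rewrite (leq_trans (size_polyD _ _))// geq_max (leq_trans (size_polyC_leq1 _))//.
    by rewrite (leq_trans (size_polyMleq _ _))// size_polyX addn2.
  rewrite -(l2sqE sz) big_ord_recl/= addrC; congr (_ + _).
    by rewrite coefD coefMX coefC add0r.
  by apply: eq_bigr => i _; rewrite coefD coefMX coefC addr0.
move=> z z1; rewrite !(hornerD, hornerC, hornerZ, hornerM, hornerX).
have ReD (x y : R[i]) : complex.Re (x + y) = complex.Re x + complex.Re y.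
  by case: x y => ? ? [].
rewrite !ReD hz//.
have sz1 : normc (s.[z] * z) ^+ 2 = normc s.[z] ^+ 2 by rewrite Normc.normcM z1 mulr1.
rewrite -sz1 -mulrA; move: (s.[z] * z) => x.
rewrite !normc_sqr; case: x => x1 x2; case: (c) => c1 c2 /=.
by ring.
Qed.

End Circle.

(** * Damping polynomials *)

Section Multiplier.
Variable R : realType.
Implicit Types (p q f g h s : {poly R[i]}).

Lemma analytic_completion_sum J (s : nat -> {poly R[i]}) :
  exists2 h : {poly R[i]}, h`_0 = ((\sum_(j < J) l2sq (s j))%:C)%C &
  forall z, normc z = 1 -> complex.Re h.[z] = \sum_(j < J) normc (s j).[z] ^+ 2.
Proof.
elim: J => [|J [h h0 hz]].
  by exists 0 => [|z _]; rewrite ?coef0 ?horner0 big_ord0.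
have [h' h'0 h'z] := analytic_completion (s J).
exists (h + h') => [|z z1]; rewrite ?coefD ?hornerD big_ord_recr/=.
  by rewrite h0 h'0 rmorphD.
by rewrite -hz// -h'z//; case: h.[z] h'.[z] => ? ? [].
Qed.

Lemma cos_ge_half (x : R) : `|x| <= 2^-1 -> 2^-1 <= cos x.
Proof.
move=> x2; rewrite -cos_norm.
have [c _] := @MVT_segment R cos (fun x => - sin x) 0 `|x| (normr_ge0 x)
  (fun y _ => is_derive_cos y) (continuous_subspaceT (@continuous_cos R)).
rewrite cos0 subr0 => h.
have : `|- sin c * `|x| | <= 2^-1.
  rewrite normrM normrN normr_id; have := sin_max c; have := normr_ge0 (sin c).
  by have := normr_ge0 x; nra.
by rewrite ler_norml => /andP[]; lra.
Qed.

(** The normalized geometric sum s = k^-1 \sum_(i < k) (e^(-ic) X)^i centred at the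
    midpoint c of the arc, with k about the inverse of the length of the arc. At
    e^(it) its terms are e^(i(t-c)j) with |t - c| j <= 1/2, so that their real parts
    are at least 1/2, while the sum of squared coefficients is 1 / k. *)
Lemma arc_poly (a b : R) : a < b -> b - a <= 1 ->
  exists s, l2sq s <= 2 * (b - a) /\
    forall t, a < t < b -> 2^-1 <= normc s.[expi t].
Proof.
move=> ab ba1; have l0 : 0 < b - a by rewrite subr_gt0.
(* k (b - a) <= 1 < 2 k (b - a) *)
pose k := Num.trunc (b - a)^-1.
have linv0 : 0 <= (b - a)^-1 by rewrite invr_ge0 ltW.
have k1 : (0 < k)%N by rewrite truncn_gt0 -[1]invr1 lef_pV2 ?posrE.
have /andP[kl lk] := truncn_itv linv0; rewrite -/k in kl lk.
have k0 : (0 : R) < k%:R by rewrite ltr0n.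
pose c := (a + b) / 2.
exists (\poly_(i < k) ((k%:R^-1)%:C%C * expi (- c) ^+ i)); split.
  rewrite -(l2sqE (size_poly _ _)).
  under eq_bigr => i _.
    rewrite coef_poly ltn_ord Normc.normcM normcX normc_expi expr1n mulr1 normc_real.
    rewrite ger0_norm ?invr_ge0 ?ler0n//.
    over.
  rewrite sumr_const card_ord -(mulr_natr (k%:R^-1 ^+ 2)) expr2 mulfVK ?gt_eqF//.
  rewrite -[leRHS]invrK lef_pV2 ?posrE ?invr_gt0 ?mulr_gt0// invfM.
  have : (1 : R) <= k%:R by rewrite ler1n.
  by rewrite -natr1 in lk; lra.
move=> t /andP[lt_at lt_tb].
have E : (\poly_(i < k) ((k%:R^-1)%:C%C * expi (- c) ^+ i)).[expi t] =
    (k%:R^-1)%:C%C * \sum_(i < k) expi (i%:R * (t - c)).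
  rewrite horner_poly mulr_sumr; apply: eq_bigr => i _.
  by rewrite -mulrA -exprMn -expiD expiX addrC.
rewrite E Normc.normcM normc_real ger0_norm ?invr_ge0 ?ler0n//.
rewrite ler_pdivlMl//; apply: le_trans (le_trans (ler_norm _) (Re_le_normc _)).
rewrite (@Re_sum _ k (fun i => expi (i%:R * (t - c)))).
rewrite -[k in k%:R]card_ord mulr_natl -sumr_const; apply: ler_sum => i _ /=.
apply: cos_ge_half; rewrite normrM ger0_norm ?ler0n//.
have ik : i%:R <= k%:R :> R by rewrite ler_nat ltnW.
have tc : `|t - c| <= (b - a) / 2.
  by rewrite ler_norml /c; apply/andP; split; lra.
apply: (@le_trans _ _ (k%:R * ((b - a) / 2))).
  by rewrite ler_pM ?ler0n.
apply: (@le_trans _ _ ((b - a)^-1 * ((b - a) / 2))).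
  by rewrite ler_wpM2r// divr_ge0// ltW.
by rewrite mulrA mulVf ?gt_eqF// mul1r.
Qed.

Lemma bernoulli_le (x : R) n : 0 <= x <= 1 -> 1 - n%:R * x <= (1 - x) ^+ n.
Proof.
move=> /andP[x0 x1]; elim: n => [|n IHn]; first by rewrite mul0r subr0.
rewrite exprS -natr1; have n0 : (0 : R) <= n%:R by rewrite ler0n.
have x10 : 0 <= 1 - x by rewrite subr_ge0.
by have := ler_wpM2l x10 IHn; nra.
Qed.

(** Take q = (1 - h / N)^N with N large. On the circle
    |1 - h / N|^2 = 1 - 2 Re h / N + |h|^2 / N^2 <= exp (-2 Re h / N + H^2 / N^2), where
    H bounds |h|, so |q|^2 <= exp (-2 Re h) exp (H^2 / N). In particular l2sq q <= 1 + e.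
    As q_0 = (1 - d / N)^N >= 1 - d by Bernoulli,
    l2sq (q - 1) = l2sq q - 2 q_0 + 1 <= e + 2 d. *)
Lemma damping_poly h (d e : R) : 0 <= d -> 0 < e -> h`_0 = (d%:C)%C ->
  (forall z, normc z = 1 -> 0 <= complex.Re h.[z]) ->
  exists q, [/\ forall z, normc z = 1 ->
      normc q.[z] ^+ 2 <= expR (- (2 * complex.Re h.[z])) * (1 + e)
    & l2sq (q - 1) <= e + 2 * d].
Proof.
move=> d0 e0 h0 hz; pose H := coef_norm1 h.
have H0 : 0 <= H := coef_norm1_ge0 h.
have e1 : 0 < 1 + e by rewrite addr_gt0.
have t0 : 0 < ln (1 + e) by rewrite ln_gt0// ltrDl.
(* N > d keeps 1 - d / N nonnegative, and N > H^2 / ln (1 + e) makes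
   exp (H^2 / N) <= 1 + e. *)
pose M := Num.max d (H ^+ 2 / ln (1 + e)).
have M0 : 0 <= M by rewrite le_max d0.
pose N := Num.bound M.
have MN : M < N%:R := archi_boundP M0.
have N0 : (0 : R) < N%:R := le_lt_trans M0 MN.
have dN : d <= N%:R by rewrite (le_trans _ (ltW MN))// le_max lexx.
have HN : H ^+ 2 / N%:R <= ln (1 + e).
  rewrite ler_pdivrMr// mulrC -ler_pdivrMr// (le_trans _ (ltW MN))//.
  by rewrite le_max lexx orbT.
pose q := (1 - (N%:R^-1)%:C%C *: h) ^+ N.
have qz z : normc z = 1 -> normc q.[z] ^+ 2 <= expR (- (2 * complex.Re h.[z])) * (1 + e).
  move=> z1; rewrite /q horner_exp normcX -exprM mulnC exprM.
  have E : normc (1 - (N%:R^-1)%:C%C *: h).[z] ^+ 2 =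
      1 + (- (2 * complex.Re h.[z]) / N%:R + (normc h.[z] / N%:R) ^+ 2).
    rewrite !(hornerD, hornerN, hornerZ, hornerC) exprMn !normc_sqr.
    by case: h.[z] => x y /=; ring.
  have hH : normc h.[z] ^+ 2 <= H ^+ 2.
    by rewrite ler_pXn2r// ?nnegrE ?normc_ge0//; exact: horner_le_norm1.
  have N_inv : (N%:R : R) * N%:R^-1 = 1 by rewrite mulfV ?gt_eqF.
  apply: (@le_trans _ _ (expR (- (2 * complex.Re h.[z]) / N%:R + (normc h.[z] / N%:R) ^+ 2) ^+ N)).
    by apply: lerXn2r; rewrite ?nnegrE ?expR_ge0 ?sqr_ge0// E expR_ge1Dx.
  have e1E : 1 + e = expR (ln (1 + e)) by rewrite lnK ?posrE.
  rewrite -expRM_natl e1E -expRD ler_expR mulrDr.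
  rewrite mulrCA N_inv mulr1 lerD2l (le_trans _ HN)//.
  rewrite exprMn [_^-1 ^+ 2]expr2 mulrCA [X in _ * X]mulrA N_inv mul1r.
  by rewrite ler_wpM2r// invr_ge0 ler0n.
exists q; split=> //.
have q0 : q`_0 = (((1 - d / N%:R) ^+ N)%:C)%C.
  rewrite -!horner_coef0 /q horner_exp !(hornerD, hornerN, hornerZ, hornerC) horner_coef0.
  by rewrite h0 rmorphXn rmorphB rmorph1 rmorphM mulrC.
have q0ge : 1 - d <= (1 - d / N%:R) ^+ N.
  have dNd : N%:R * (d / N%:R) = d by rewrite mulrC mulfVK// gt_eqF.
  rewrite -{1}dNd; apply: bernoulli_le.
  by rewrite divr_ge0 ?ler0n//= ler_pdivrMr// mul1r.
have lq : l2sq q <= 1 + e.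
  have -> : 1 + e = (1 + e) * l2sq (1 : {poly R[i]}).
    by rewrite /l2sq size_poly1 big_ord_recr big_ord0/= coef1 Normc.normc1 expr1n add0r mulr1.
  apply: l2sq_le_circle => z z1; rewrite hornerC Normc.normc1 expr1n mulr1.
  apply: (le_trans (qz z z1)); rewrite ler_piMl ?(ltW e1)//.
  by rewrite expR_le1 oppr_le0 mulr_ge0// hz.
have : l2sq (q - 1) = l2sq q - 2 * (1 - d / N%:R) ^+ N + 1.
  pose n := (size q).+1.
  have s1 : (size (q - 1)%R <= n)%N.
    by rewrite (leq_trans (size_polyD _ _))// size_polyN size_poly1 geq_max leqnSn.
  rewrite -(l2sqE s1) -(l2sqE (leqnSn (size q))) !big_ord_recl/=.
  have subE (x : R) : (x%:C)%C - 1 = ((x - 1)%:C)%C :> R[i] by rewrite rmorphB rmorph1.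
  rewrite coefB coef1 eqxx q0 subE !normc_real !real_normK ?num_real//.
  under eq_bigr do rewrite coefB coef1 subr0.
  move: (\sum_(i < size q) _) ((1 - d / N%:R) ^+ N) => a b.
  by ring.
move=> ->; move: ((1 - d / N%:R) ^+ N) q0ge (l2sq q) lq => a + b; clear; lra.
Qed.

End Multiplier.

(** * Small arcs around a Lebesgue null set *)

Section Arcs.
Variable R : realType.

Lemma polar_form (x : R * R) : unit_circle R x ->
  exists2 t : R, 0 <= t < 2 * pi & x = circle_param t.
Proof.
case: x => x y; rewrite /unit_circle /circle_param /= => xy1.
have {}xy1 : x ^+ 2 + y ^+ 2 = 1.
  by rewrite -[LHS]sqr_sqrtr ?addr_ge0 ?sqr_ge0// xy1 expr1n.
have x1 : -1 <= x <= 1.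
  rewrite -ler_norml -(@ler_pXn2r _ 2) ?nnegrE// expr1n real_normK ?num_real//.
  by rewrite -xy1 lerDl sqr_ge0.
have sE : sin (acos x) = `|y|.
  rewrite sin_acos// -sqrtr_sqr; congr Num.sqrt.
  by rewrite -xy1 addrC addKr.
have cE : cos (acos x) = x by rewrite acosK.
have pi0 := pi_gt0 R; have a0 := acos_ge0 x1; have api := acos_lepi x1.
have [y0|y0] := leP 0 y.
  exists (acos x); first by apply/andP; split => //; lra.
  by rewrite cE sE ger0_norm.
(* Lower half of the circle; here x <> 1, so that the angle is below 2 pi. *)
exists (pi *+ 2 - acos x).
  have ax0 : acos x != 0.
    by apply/eqP => ax0; move: sE; rewrite ax0 sin0 => /esym/eqP; rewrite normr_eq0 lt_eqF.
  have : 0 < acos x by rewrite lt_def ax0.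
  by rewrite -mulr_natl => ?; apply/andP; split; lra.
have c2 : cos (pi *+ 2 - acos x) = x by rewrite cosB cos2pi sin2pi mul0r mul1r addr0.
have s2 : sin (pi *+ 2 - acos x) = y.
  by rewrite sinB cos2pi sin2pi mul0r mul1r sub0r sE ltr0_norm// opprK.
by rewrite c2 s2.
Qed.

(** A Lebesgue null set of parameters has countable covers by open intervals of
    arbitrarily small total length, since Lebesgue measure is an outer measure; each
    interval carries the polynomial of [arc_poly]. *)
Lemma null_cover (S : set (R * R)) (e : R) : 0 < e -> e <= 1 ->
  circle_measure R S = 0%E ->
  exists s : nat -> {poly R[i]},
    (forall J, \sum_(j < J) l2sq (s j) <= e) /\
    (forall x, unit_circle R x -> S x -> exists k, 4^-1 <= normc (s k).[toC x] ^+ 2).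
Proof.
move=> e0 e1; pose B := @circle_param R @^-1` S `&` [set` `[0, 2 * pi[%R].
move=> S0.
have B0 : ((wlength (@idfun R))^*)%mu B = 0%E by exact: S0.
have e2 : 0 < e / 2 by rewrite divr_gt0.
have [F [Fitv BF] Fe] : exists2 F, open_itv_cover B F &
    (\sum_(0 <= k <oo) wlength (@idfun R) (F k) < (e / 2)%:E)%E.
  move: B0; rewrite outer_measure_open_itv_cover => B0.
  have fB : ereal_inf [set (\sum_(0 <= k <oo) wlength (@idfun R) (F k))%E |
    F in open_itv_cover B] \is a fin_num by rewrite B0.
  have [_ [F HF <-]] := lb_ereal_inf_adherent e2 fB.
  by rewrite B0 add0e; exists F.
have wF0 k : (0 <= wlength (@idfun R) (F k))%E.
  by have [[a b] ->] := Fitv k; apply: wlength_itv_ge0.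
have wle J : (\sum_(0 <= k < J) wlength (@idfun R) (F k) < (e / 2)%:E)%E.
  by apply: le_lt_trans Fe; apply: nneseries_lim_ge => n _ _; exact: wF0.
have ex k : exists s : {poly R[i]}, ((l2sq s)%:E <= 2%:E * wlength (@idfun R) (F k))%E /\
    forall t, F k t -> 2^-1 <= normc s.[expi t].
  have := wle k.+1; have [[a b] FE] := Fitv k.
  have [ab|ba] := ltP a b; last first.
    exists 0; rewrite /l2sq size_poly0 big_ord0 mule_ge0// FE; split=> // t /=.
    by rewrite in_itv/= => /andP[at_ tb]; move: (lt_trans at_ tb); rewrite ltNge ba.
  have wE : wlength (@idfun R) (F k) = (b - a)%:E.
    by rewrite FE wlength_itv_bnd// ltW.
  rewrite big_nat_recr//= wE => h.
  have ba1 : b - a <= 1.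
    have : ((b - a)%:E < (e / 2)%:E)%E.
      by apply: le_lt_trans h; rewrite leeDr// sume_ge0.
    by rewrite lte_fin; lra.
  have [s [s1 s2]] := arc_poly ab ba1.
  exists s; split; first by rewrite -EFinM lee_fin.
  by move=> t; rewrite FE /= in_itv/=; exact: s2.
have [s sP] := choice ex.
exists s; split=> [J|x Tx Sx].
  rewrite -lee_fin -sumEFin -(big_mkord xpredT (fun j => (l2sq (s j))%:E)).
  apply: (@le_trans _ _ (\sum_(0 <= k < J) 2%:E * wlength (@idfun R) (F k))%E).
    by apply: lee_sum => k _; case: (sP k).
  rewrite -ge0_sume_distrr//.
  have := ltW (wle J); rewrite -(@lee_pmul2l _ 2%:E)//.
  by rewrite -EFinM mulrC divfK.
have [t t2 xt] := polar_form Tx.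
have Bt : B t by split; rewrite /= ?in_itv//= -xt.
have [k _ Fkt] := BF _ Bt; exists k.
have [_ /(_ t Fkt) h] := sP k; rewrite xt.
have -> : 4^-1 = 2^-1 ^+ 2 :> R by rewrite exprVn -natrX.
by rewrite ler_pXn2r// ?nnegrE ?normc_ge0 ?invr_ge0.
Qed.

Lemma measurable_horner_ge (s : {poly R[i]}) (c : R) :
  measurable [set x : R * R | c <= normc s.[toC x] ^+ 2].
Proof.
rewrite -[X in measurable X]setTI; apply: measurable_fun_le => //.
exact: (measurable_normc_sqr (cmeasurable_horner s)).
Qed.

Definition large_set (s : nat -> {poly R[i]}) (J : nat) : set (R * R) :=
  [set x | exists2 j : nat, (j < J)%N & 4^-1 <= normc (s j).[toC x] ^+ 2].

(** By continuity from above: the points that escape the first J arcs decrease, as J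
    grows, to a set on which sigma vanishes. *)
Lemma null_cover_finite (sigma : {measure set (R * R) -> \bar R})
    (S : set (R * R)) (e : R) : 0 < e -> e <= 1 ->
  (sigma setT < +oo)%E -> measurable S ->
  sigma (~` unit_circle R) = 0%E -> sigma (~` S) = 0%E ->
  circle_measure R S = 0%E ->
  exists (s : nat -> {poly R[i]}) (J : nat),
    \sum_(j < J) l2sq (s j) <= e /\
    (sigma (~` large_set s J) <= e%:E)%E.
Proof.
move=> e0 e1 sfin mS sT sS S0.
have [s [s1 s2]] := null_cover e0 e1 S0.
pose U k := [set x : R * R | 4^-1 <= normc (s k).[toC x] ^+ 2].
pose V J := \bigcap_(k in `I_J) ~` U k.
have mU k : measurable (~` U k) by apply: measurableC; exact: measurable_horner_ge.
have mV J : measurable (V J).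
  by apply: fin_bigcap_measurable => [|k _]; [exact: finite_II|exact: mU].
have mVV : measurable (\bigcap_J V J) by exact: bigcap_measurable.
have V0 : sigma (\bigcap_J V J) = 0%E.
  have mT := @measurable_unit_circle R.
  have sub : \bigcap_J V J `<=` ~` unit_circle R `|` ~` S.
    move=> x Vx; apply/not_andP => -[Tx Sx].
    have [k Uk] := s2 x Tx Sx; exact: (Vx k.+1 I k (ltnSn k) Uk).
  apply/eqP; rewrite eq_le measure_ge0 andbT.
  apply: (le_trans (le_measure sigma _ _ sub)); rewrite ?inE//.
    by apply: measurableU; exact: measurableC.
  apply: (le_trans (measureU2 sigma (measurableC mT) (measurableC mS))).
  by rewrite [X in (X + _)%E]sT [X in (_ + X)%E]sS adde0.
have cV : sigma (V J) @[J --> \oo] --> sigma (\bigcap_J V J).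
  apply: nonincreasing_cvg_mu => //.
    by apply: le_lt_trans sfin; apply: le_measure; rewrite ?inE.
  by move=> n m nm; apply/subsetPset => x Vx k kn; apply: Vx; exact: leq_trans nm.
have [J _ JP] : \forall J \near \oo, (sigma (V J) < e%:E)%E.
  rewrite V0 in cV.
  have fV J : sigma (V J) \is a fin_num.
    by rewrite ge0_fin_numE//; apply: le_lt_trans sfin; apply: le_measure; rewrite ?inE.
  have /fine_cvg/cvgr_lt : sigma (V J) @[J --> \oo] --> (0:R)%:E by [].
  move=> /(_ e e0); apply: filterS => J /=; rewrite -lte_fin fineK//.
exists s, J; split => //.
rewrite (_ : ~` _ = V J); first by apply: ltW; apply: JP => /=.
apply/seteqP; split=> x /=.
  by move=> h k kJ Uk; apply: h; exists k.
by move=> Vx [k kJ Uk]; exact: (Vx k kJ Uk).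
Qed.

End Arcs.

(** * Erasing the singular part *)

Section Transfer.
Variable R : realType.
Implicit Types (m nu sigma : {measure set (R * R) -> \bar R}) (p q : {poly R[i]}).

Local Notation sq p := (fun z : R * R => (normc p.[toC z] ^+ 2)%:E).

Lemma measurable_sq p : measurable_fun setT (sq p).
Proof.
by apply/measurable_EFinP; exact: measurable_normc_sqr (cmeasurable_horner p).
Qed.

Lemma finite_moments_le m1 m2 :
  (forall S : set (R * R), measurable S -> (m1 S <= m2 S)%E) ->
  finite_moments m2 -> finite_moments m1.
Proof.
move=> m12 fm n; have /integrableP[mf fi] := fm n.
apply/integrableP; split=> //; apply: le_lt_trans fi.
apply: ge0_le_measure_integral => //; exact: measurableT_comp.
Qed.

Lemma energy_le m1 m2 p :
  (forall S : set (R * R), measurable S -> (m1 S <= m2 S)%E) ->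
  finite_moments m2 -> energy m1 p <= energy m2 p.
Proof.
move=> m12 fm2; have fm1 := finite_moments_le m12 fm2.
rewrite -lee_fin !EFin_energy//; apply: ge0_le_measure_integral => //.
  by move=> z; rewrite lee_fin sqr_ge0.
exact: measurable_sq.
Qed.

Lemma coef_bound_le m1 m2 n (c : R) : 0 <= c ->
  (forall S : set (R * R), measurable S -> (m1 S <= m2 S)%E) ->
  finite_moments m2 -> coef_bound m1 n c -> coef_bound m2 n c.
Proof.
move=> c0 m12 fm2 h p; apply: le_trans (h p) _.
by rewrite ler_wpM2l// energy_le.
Qed.

Lemma finite_moments_lty m : finite_moments m -> (m setT < +oo)%E.
Proof.
move=> /(_ 0%N)/integrableP[_].
under eq_integral do rewrite expr0 gee0_abs ?lee_fin//.
by rewrite integral_cst// mul1e.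
Qed.

Lemma ae_circle sigma (Q : R * R -> Prop) : sigma (~` unit_circle R) = 0%E ->
  (forall z, unit_circle R z -> Q z) -> {ae sigma, forall z, Q z}.
Proof.
move=> s0 h; exists (~` unit_circle R); split=> //.
  by apply: measurableC; exact: measurable_unit_circle.
by move=> z Qz Tz; apply: Qz; exact: h.
Qed.

Variables (nu nu_a nu_s : {measure set (R * R) -> \bar R}).
Hypothesis fnu : finite_moments nu.
Hypothesis nuT : nu (~` unit_circle R) = 0%E.
Hypothesis nuE : forall S : set (R * R), measurable S -> nu S = (nu_a S + nu_s S)%E.

Lemma le_nu_a (S : set (R * R)) : measurable S -> (nu_a S <= nu S)%E.
Proof. by move=> mS; rewrite nuE// leeDl. Qed.

Lemma le_nu_s (S : set (R * R)) : measurable S -> (nu_s S <= nu S)%E.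
Proof. by move=> mS; rewrite nuE// leeDr. Qed.

Let fa := finite_moments_le le_nu_a fnu.
Let fs := finite_moments_le le_nu_s fnu.

Let mTC : measurable (~` unit_circle R).
Proof. by apply: measurableC; exact: measurable_unit_circle. Qed.

Let aT : nu_a (~` unit_circle R) = 0%E.
Proof. by apply/eqP; rewrite eq_le measure_ge0 andbT -nuT le_nu_a. Qed.

Let sT : nu_s (~` unit_circle R) = 0%E.
Proof. by apply/eqP; rewrite eq_le measure_ge0 andbT -nuT le_nu_s. Qed.

Lemma energyD p : energy nu p = energy nu_a p + energy nu_s p.
Proof.
apply: EFin_inj; rewrite EFinD !EFin_energy//.
rewrite -(integral_measure_add measurableT (integrable_normc_sqr fa p)
  (integrable_normc_sqr fs p)).
apply: eq_measure_integral => S mS _; rewrite nuE//.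
exact/esym/(measure_addE nu_a nu_s S).
Qed.

(** Apply [damping_poly] to h = e^-1 h0, where Re h0 = \sum_j |s_j|^2 for arcs of total
    size e^2 missing at most e^2 of nu_s: then h(0) <= e, while Re h >= (4 e)^-1 on
    the arcs, so that |q|^2 <= 4 e there. The error is linear in e with a constant that
    depends on p and nu_s only. *)
Lemma singular_damping p (e : R) : 0 < e <= 1 ->
  mutually_singular nu_s (circle_measure R) ->
  exists q, l2sq (q - 1) <= 3 * e /\
    energy nu (p * q) <= (1 + e) * energy nu_a p +
      e * (coef_norm1 p ^+ 2 * (4 * fine (nu_s setT) + 2)).
Proof.
move=> /andP[e0 e1] [S [mS sS mS0]].
(* Arcs of total size e^2, so that h(0) <= e after scaling by e^-1. *)
have d0 : 0 < e ^+ 2 by rewrite exprn_gt0.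
have d1 : e ^+ 2 <= 1 by rewrite expr_le1// ltW.
have sfin := finite_moments_lty fs.
have [s [J [sJ large]]] := null_cover_finite d0 d1 sfin mS sT sS mS0.
have [h0 h00 h0z] := analytic_completion_sum J s.
pose h := (e^-1)%:C%C *: h0.
have einv0 : 0 <= e^-1 by rewrite invr_ge0 ltW.
have hz z : normc z = 1 -> complex.Re h.[z] = e^-1 * \sum_(j < J) normc (s j).[z] ^+ 2.
  by move=> z1; rewrite -h0z// hornerZ; case: h0.[z] => x y /=; rewrite mul0r subr0.
have sum0 z : 0 <= \sum_(j < J) normc (s j).[z] ^+ 2.
  by apply: sumr_ge0 => j _; exact: sqr_ge0.
pose d := e^-1 * \sum_(j < J) l2sq (s j).
have dge0 : 0 <= d by rewrite mulr_ge0// sumr_ge0// => j _; exact: l2sq_ge0.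
have de : d <= e.
  by rewrite /d ler_pdivrMl// -expr2.
have h_0 : h`_0 = (d%:C)%C by rewrite coefZ h00 -rmorphM.
have [|q [qz lq]] := damping_poly dge0 e0 h_0.
  by move=> z z1; rewrite hz// mulr_ge0.
exists q; split; first by apply: (le_trans lq); lra.
set P := coef_norm1 p.
have P0 : 0 <= P := coef_norm1_ge0 p.
have qle z : normc z = 1 -> normc q.[z] ^+ 2 <= 1 + e.
  move=> z1; apply: (le_trans (qz z z1)); rewrite ler_piMl//.
    by rewrite addr_ge0// ltW.
  by rewrite expR_le1 oppr_le0 mulr_ge0// hz// mulr_ge0.
have qsmall z : normc z = 1 -> (exists2 j : nat, (j < J)%N & 4^-1 <= normc (s j).[z] ^+ 2) ->
    normc q.[z] ^+ 2 <= 4 * e.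
  move=> z1 [j jJ sj]; apply: (le_trans (qz z z1)).
  have u4 : (4 * e)^-1 <= complex.Re h.[z].
    rewrite hz// invfM mulrC ler_wpM2l// (le_trans sj)//.
    rewrite (bigD1 (Ordinal jJ))//= lerDl sumr_ge0// => k _; exact: sqr_ge0.
  have x0 : 0 < (2 * e)^-1 by rewrite invr_gt0 mulr_gt0.
  have : expR (- (2 * complex.Re h.[z])) <= 2 * e.
    rewrite expRN -[leRHS]invrK lef_pV2 ?posrE ?expR_gt0//.
    apply: le_trans (expR_ge1Dx _); rewrite -[leLHS]add0r lerD//.
    apply: le_trans (ler_wpM2l _ u4) => //.
    by rewrite !invfM mulrA; lra.
  by move=> hx; have := expR_ge0 (- (2 * complex.Re h.[z])); nra.
rewrite energyD; apply: lerD.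
  rewrite -lee_fin EFinM !EFin_energy//.
  rewrite -ge0_integralZl//=; last 3 first.
    - exact: measurable_sq.
    - by move=> z _; rewrite lee_fin sqr_ge0.
    - by rewrite lee_fin addr_ge0// ltW.
  apply: ae_ge0_le_integral => //.
  - by move=> z _; rewrite lee_fin sqr_ge0.
  - exact: measurable_sq.
  - by move=> z _; rewrite lee_fin mulr_ge0 ?sqr_ge0// addr_ge0// ltW.
  - by apply: measurable_funeM; exact: measurable_sq.
  apply: (ae_circle aT) => z z1 _.
  rewrite lee_fin hornerM Normc.normcM exprMn mulrC ler_wpM2r ?sqr_ge0//.
  exact: qle.
pose V := ~` large_set s J.
have mV : measurable V.
  apply: measurableC.
  rewrite (_ : large_set s J = \bigcup_(j in `I_J) [set x | 4^-1 <= normc (s j).[toC x] ^+ 2]).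
    by apply: bigcup_measurable => k _; exact: measurable_horner_ge.
  by apply/seteqP; split=> x [j jJ sj]; exists j.
have sfinT : nu_s setT \is a fin_num by rewrite ge0_fin_numE.
rewrite -lee_fin EFin_energy//.
apply: (@le_trans _ _ (\int[nu_s]_z (P ^+ 2 * (4 * e) + P ^+ 2 * 2 * \1_V z)%:E)%E).
  apply: ae_ge0_le_integral => //.
  - by move=> z _; rewrite lee_fin sqr_ge0.
  - exact: measurable_sq.
  - move=> z _; rewrite lee_fin addr_ge0 ?mulr_ge0 ?sqr_ge0 ?(ltW e0)//.
  - apply/measurable_EFinP; apply: measurable_funD => //.
    by apply: measurable_funM => //; exact: measurable_indic.
  apply: (ae_circle sT) => z z1 _.
  have pz : normc p.[toC z] ^+ 2 <= P ^+ 2.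
    by rewrite ler_pXn2r// ?nnegrE ?normc_ge0//; exact: horner_le_norm1.
  rewrite lee_fin hornerM Normc.normcM exprMn -mulrA -mulrDr.
  apply: ler_pM => //; rewrite ?sqr_ge0//.
  rewrite indicE; case: (boolP (z \in V)) => [_|/negP zV].
    by rewrite mulr1; apply: (le_trans (qle _ z1)); lra.
  rewrite mulr0 addr0; apply: qsmall => //; apply: contrapT => nl; apply: zV.
  by rewrite inE.
under eq_integral do rewrite EFinD.
rewrite ge0_integralD//=; last 3 first.
  - by move=> z _; rewrite lee_fin !mulr_ge0 ?sqr_ge0// ltW.
  - by move=> z _; rewrite lee_fin !mulr_ge0 ?sqr_ge0.
  - by apply/measurable_EFinP; apply: measurable_funM => //; exact: measurable_indic.
rewrite integral_cst//.
under [X in (_ + X)%E]eq_integral do rewrite EFinM.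
rewrite ge0_integralZl//; last 2 first.
  - by apply/measurable_EFinP; exact: measurable_indic.
  - by rewrite lee_fin mulr_ge0 ?sqr_ge0.
rewrite integral_indic// setIT -(fineK sfinT).
have vfin : nu_s V \is a fin_num.
  by rewrite ge0_fin_numE//; apply: le_lt_trans sfin; apply: le_measure; rewrite ?inE.
move: large; rewrite -/V -(fineK vfin) lee_fin => large.
rewrite -!EFinM -EFinD lee_fin /=.
have : P ^+ 2 * fine (nu_s V) <= P ^+ 2 * e.
  by rewrite ler_wpM2l ?sqr_ge0// (le_trans large)// expr2 ler_piMl// ltW.
nra.
Qed.

End Transfer.

(** * Transfer of coefficient bounds *)

Section BoundTransfer.
Variable R : realType.
Implicit Types (p q : {poly R[i]}).

Lemma le_of_linear_error (a b K : R) :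
  (forall t, 0 < t <= 1 -> a <= b + K * t) -> a <= b.
Proof.
move=> h; apply/ler_addgt0Pr => e e0.
have K1 : 0 < `|K| + 1 by rewrite ltr_wpDl.
pose t := Num.min 1 (e / (`|K| + 1)).
have t0 : 0 < t by rewrite lt_min ltr01 divr_gt0.
have := h t; rewrite t0 ge_min lexx => /(_ isT) /le_trans; apply.
rewrite lerD2l; apply: (@le_trans _ _ ((`|K| + 1) * t)).
  by rewrite ler_wpM2r ?(ltW t0)// (le_trans (ler_norm K))// lerDl.
apply: (@le_trans _ _ ((`|K| + 1) * (e / (`|K| + 1)))).
  by rewrite ler_pM2l// ge_min lexx orbT.
by rewrite mulrC mulfVK ?gt_eqF.
Qed.

Lemma normc_sqrD_le (x y : R[i]) (t : R) : 0 < t ->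
  normc (x + y) ^+ 2 <= (1 + t) * normc x ^+ 2 + (1 + t^-1) * normc y ^+ 2.
Proof.
move=> t0; have h := le_normcD x y.
apply: (@le_trans _ _ ((normc x + normc y) ^+ 2)).
  by rewrite ler_pXn2r// ?nnegrE ?addr_ge0 ?normc_ge0//.
rewrite -subr_ge0.
have -> : (1 + t) * normc x ^+ 2 + (1 + t^-1) * normc y ^+ 2 - (normc x + normc y) ^+ 2 =
    t^-1 * (t * normc x - normc y) ^+ 2.
  by field; rewrite gt_eqF.
by rewrite mulr_ge0 ?sqr_ge0// invr_ge0 ltW.
Qed.

(** For q close to 1 in l2, the bound of p q by the energy of nu passes to the limit:
    p = p q + p (1 - q), where the last term is small in l2 because p is bounded on
    the circle. With t measuring the splitting of the square and e = t^2 in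
    [singular_damping], all errors are linear in t. *)
Lemma coef_bound_ac (nu nu_a nu_s : {measure set (R * R) -> \bar R}) n (c : R) :
  finite_moments nu -> nu (~` unit_circle R) = 0%E ->
  (forall S : set (R * R), measurable S -> nu S = (nu_a S + nu_s S)%E) ->
  mutually_singular nu_s (circle_measure R) ->
  0 <= c -> coef_bound nu n c -> coef_bound nu_a n c.
Proof.
move=> fnu nuT nuE sing c0 hnu p.
set N := fun f : {poly R[i]} => \sum_(i < n) normc f`_i ^+ 2.
set P := coef_norm1 p; set Ea := energy nu_a p.
pose K0 := P ^+ 2 * (4 * fine (nu_s setT) + 2).
have Ea0 : 0 <= Ea := energy_ge0 _ _.
have P0 : 0 <= P := coef_norm1_ge0 p.
have K00 : 0 <= K0.
  by rewrite mulr_ge0 ?sqr_ge0// addr_ge0// mulr_ge0// fine_ge0.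
apply: (@le_of_linear_error _ _ (c * (3 * Ea + 2 * K0) + 6 * P ^+ 2)) => t /andP[t0 t1].
have t2 : 0 < t ^+ 2 <= 1 by rewrite exprn_gt0//= expr_le1// ltW.
have [q [lq eq]] := singular_damping fnu nuT nuE p t2 sing.
have ND : N p <= (1 + t) * N (p * q) + (1 + t^-1) * N (p * (1 - q)).
  rewrite /N !mulr_sumr -big_split; apply: ler_sum => i _ /=.
  have -> : p`_i = (p * q)`_i + (p * (1 - q))`_i.
    by rewrite -coefD -mulrDr addrC subrK mulr1.
  exact: normc_sqrD_le.
have N1 : N (p * (1 - q)) <= P ^+ 2 * (3 * t ^+ 2).
  apply: (le_trans (coef_sum_le_l2sq _ _)).
  apply: (@le_trans _ _ (P ^+ 2 * l2sq (q - 1))); last by rewrite ler_wpM2l ?sqr_ge0.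
  apply: l2sq_le_circle => z z1; rewrite hornerM Normc.normcM exprMn.
  rewrite -[1 - q]opprB hornerN normcN ler_wpM2r ?sqr_ge0//.
  by rewrite ler_pXn2r// ?nnegrE ?normc_ge0//; exact: horner_le_norm1.
have N2 : N (p * q) <= c * ((1 + t ^+ 2) * Ea + t ^+ 2 * K0).
  by apply: (le_trans (hnu _)); rewrite ler_wpM2l.
have s1 : t ^+ 2 <= t by rewrite expr2 ler_piMl// ltW.
have tt : t^-1 * t ^+ 2 = t by rewrite expr2 mulrA mulVf ?mul1r// gt_eqF.
have b1 : (1 + t^-1) * N (p * (1 - q)) <= P ^+ 2 * (6 * t).
  have tinv : 0 <= 1 + t^-1 by rewrite addr_ge0// invr_ge0 ltW.
  apply: (le_trans (ler_wpM2l tinv N1)).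
  have -> : (1 + t^-1) * (P ^+ 2 * (3 * t ^+ 2)) = P ^+ 2 * (3 * (t ^+ 2 + t^-1 * t ^+ 2)) by ring.
  rewrite tt ler_wpM2l ?sqr_ge0//.
  by lra.
have b2 : (1 + t) * N (p * q) <= c * (Ea + (3 * Ea + 2 * K0) * t).
  have t10 : 0 <= 1 + t by rewrite addr_ge0// ltW.
  apply: (le_trans (ler_wpM2l t10 N2)); rewrite mulrCA ler_wpM2l//.
  have s2 : t ^+ 3 <= t.
    by rewrite exprS -[leRHS]mulr1 ler_wpM2l ?expr_le1// ltW.
  have -> : (1 + t) * ((1 + t ^+ 2) * Ea + t ^+ 2 * K0) =
     Ea + (t + t ^+ 2 + t ^+ 3) * Ea + (t ^+ 2 + t ^+ 3) * K0 by ring.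
  have := ler_wpM2r Ea0 s1; have := ler_wpM2r Ea0 s2.
  have := ler_wpM2r K00 s1; have := ler_wpM2r K00 s2.
  by lra.
apply: (le_trans ND); apply: (le_trans (lerD b2 b1)).
rewrite le_eqVlt; apply/orP; left; apply/eqP; ring.
Qed.

Definition rational_box (w : rat * rat * (rat * rat)) : set (R * R) :=
  `]ratr w.1.1, ratr w.1.2[%classic `*` `]ratr w.2.1, ratr w.2.2[%classic.

Lemma open_rational_box (U : set (R * R)) x : open U -> U x ->
  exists w, rational_box w x /\ rational_box w `<=` U.
Proof.
move=> oU Ux; have /nbhs_ballP[e /= e0 eU] : nbhs x U by exact: open_nbhs_nbhs.
have rat_itv (a : R) : exists q : rat * rat,
    `]ratr q.1, ratr q.2[%classic a /\ forall b, `]ratr q.1, ratr q.2[%classic b -> `|a - b| < e.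
  have la : a - e < a by rewrite ltrBlDr ltrDl.
  have ra : a < a + e by rewrite ltrDl.
  have [q1 q1P] := rat_in_itvoo la; have [q2 q2P] := rat_in_itvoo ra.
  move: q1P q2P; rewrite !in_itv/= => /andP[? ?] /andP[? ?].
  exists (q1, q2); split; first by rewrite /= in_itv/=; apply/andP.
  move=> b /=; rewrite in_itv/= => /andP[? ?]; rewrite ltr_norml.
  by apply/andP; split; lra.
have [q1 [q1x q1b]] := rat_itv x.1; have [q2 [q2x q2b]] := rat_itv x.2.
exists (q1, q2); split => // y [y1 y2]; apply: eU; split.
  by rewrite /ball/=; exact: q1b.
by rewrite /ball/=; exact: q2b.
Qed.

Lemma bigcup_rational_box (Q : set (R * R) -> Prop) :
  let G n := if unpickle n is Some w then
    (if `[< Q (rational_box w) >] then rational_box w else set0) else set0 in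
  forall x, (exists w, rational_box w x /\ Q (rational_box w)) -> (\bigcup_n G n) x.
Proof.
move=> G x [w [wx Qw]]; exists (pickle w); first exact: I.
by rewrite /G pickleK; case: asboolP => [_|/(_ Qw)[]]; exact: wx.
Qed.

Lemma measurable_rational_box w : measurable (rational_box w).
Proof. by apply: measurableX. Qed.

(** The plane carries the product sigma-algebra, for which only products are
    measurable by construction; an open set is the countable union of the rational
    boxes that it contains. *)
Lemma open_measurable_plane (U : set (R * R)) : open U -> measurable U.
Proof.
move=> oU; pose G n := if unpickle n is Some w then
  (if `[< rational_box w `<=` U >] then rational_box w else set0) else set0.
rewrite (_ : U = \bigcup_n G n).
  apply: bigcup_measurable => n _; rewrite /G; case: unpickle => [w|] //.
  by case: ifP => // _; exact: measurable_rational_box.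
apply/seteqP; split=> [x Ux|x [n _]].
  exact: (@bigcup_rational_box (fun V => V `<=` U)) (open_rational_box oU Ux).
by rewrite /G; case: unpickle => [w|] //; case: asboolP => // wU /wU.
Qed.

(** The complement of the support is covered by the countably many rational boxes of
    measure 0. *)
Lemma support_null (mu : {measure set (R * R) -> \bar R}) (D : set (R * R)) :
  topological_support mu `<=` D -> mu.-negligible (~` D).
Proof.
move=> suppD; pose G n := if unpickle n is Some w then
  (if `[< mu (rational_box w) = 0%E >] then rational_box w else set0) else set0.
have Gn n : mu.-negligible (G n).
  rewrite /G; case: unpickle => [w|]; last exact: negligible_set0.
  case: asboolP => [b0|_]; last exact: negligible_set0.
  by exists (rational_box w); split => //; exact: measurable_rational_box.
apply: negligibleS (negligible_bigcup Gn) => x Dx.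
have [U [oU Ux U0]] : exists U : set (R * R), [/\ open U, U x & mu U = 0%E].
  apply: contrapT => h; apply: Dx; apply: suppD => U oU Ux.
  by rewrite lt_def measure_ge0 andbT; apply/eqP => U0; apply: h; exists U.
apply: (@bigcup_rational_box (fun V => mu V = 0%E)).
have [w [wx wU]] := open_rational_box oU Ux; exists w; split => //.
apply/eqP; rewrite eq_le measure_ge0 andbT -U0; apply: le_measure => //; rewrite ?inE.
  exact: measurable_rational_box.
exact: open_measurable_plane.
Qed.

Variable mu : {measure set (R * R) -> \bar R}.
Hypothesis fmu : finite_moments mu.

Lemma restr_circle_le (S : set (R * R)) : measurable S -> (restr_circle mu S <= mu S)%E.
Proof.
move=> mS; apply: le_measure; rewrite ?inE//.
by apply: measurableI => //; exact: measurable_unit_circle.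
Qed.

Lemma restr_circleC : restr_circle mu (~` unit_circle R) = 0%E.
Proof. by rewrite /restr_circle/= /mrestr setICl measure0. Qed.

(** Split mu into its restrictions to the circle and to the complement of the
    circle; the integrand vanishes on the latter. *)
Lemma energy_restr_circle p : (energy (restr_circle mu) p)%:E =
  (\int[mu]_z (normc p.[toC z] ^+ 2 * \1_(unit_circle R) z)%:E)%E.
Proof.
have mT := @measurable_unit_circle R.
have mTC := measurableC mT.
have fnu := finite_moments_le restr_circle_le fmu.
set g := fun z => (normc p.[toC z] ^+ 2 * \1_(unit_circle R) z)%:E.
have g0 z : (0 <= g z)%E by rewrite lee_fin mulr_ge0 ?sqr_ge0.
have mg : measurable_fun setT g.
  apply/measurable_EFinP; apply: measurable_funM; last exact: measurable_indic.
  exact: measurable_normc_sqr (cmeasurable_horner p).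
rewrite EFin_energy//.
transitivity (\int[measure_add (mrestr mu mT) (mrestr mu mTC)]_z g z)%E; last first.
  apply: eq_measure_integral => S mS _.
  rewrite [LHS]measure_addE /= /mrestr -measureU; last 3 first.
  - exact: measurableI.
  - exact: measurableI.
  - by rewrite setIACA setICr setI0.
  by rewrite -setIUr setUCr setIT.
rewrite ge0_integral_measure_add//.
rewrite [X in (_ + X)%E](_ : _ = 0%E) ?adde0.
  apply: ge0_ae_eq_integral => //.
  - exact: measurable_sq.
  - by move=> z _; rewrite lee_fin sqr_ge0.
  - apply: (ae_circle restr_circleC) => z z1 _.
    by rewrite /g indicE mem_set ?mulr1.
rewrite -(integral0 (mrestr mu mTC) setT); apply: ge0_ae_eq_integral => //.
exists (unit_circle R); split => //.
  by rewrite /= /mrestr setICr measure0.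
move=> z /= h; apply: contrapT => z1; apply: h => _.
by rewrite /g indicE memNset ?mulr0.
Qed.

(** The coefficients of p and of p X^k are the same up to a shift, and the energy of
    p X^k tends to the energy of p on the circle by dominated convergence. *)
Lemma coef_bound_restr_circle (c : R) : 0 <= c ->
  mu.-negligible (~` closed_disk R) ->
  (forall n, coef_bound mu n c) -> forall n, coef_bound (restr_circle mu) n c.
Proof.
move=> c0 negD hmu n p.
pose f k z : \bar R := (normc (p * 'X^k).[toC z] ^+ 2)%:E.
pose g z : \bar R := (normc p.[toC z] ^+ 2 * \1_(unit_circle R) z)%:E.
have mT := @measurable_unit_circle R.
have mg : measurable_fun setT g.
  apply/measurable_EFinP; apply: measurable_funM; last exact: measurable_indic.
  exact: measurable_normc_sqr (cmeasurable_horner p).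
have fE k z : f k z = (normc p.[toC z] ^+ 2 * (normc (toC z) ^+ 2) ^+ k)%:E.
  by rewrite /f hornerM hornerXn Normc.normcM normcX exprMn -!exprM mulnC.
have aeD (Q : R * R -> Prop) : (forall z, closed_disk R z -> Q z) -> {ae mu, forall z, Q z}.
  by move=> h; apply: negligibleS negD => z Qz Dz; apply: Qz; exact: h.
have [_ _] : [/\ mu.-integrable setT g,
    [sequence \int[mu]_z `|f k z - g z|]_k @ \oo --> 0%E &
    [sequence \int[mu]_z f k z]_k @ \oo --> \int[mu]_z g z]%E.
  apply: (@dominated_convergence _ _ _ _ _ _ _ _ (fun z => (normc p.[toC z] ^+ 2)%:E)) => //.
  - by move=> k; exact: measurable_sq.
  - apply: aeD => z Dz _; under eq_cvg do rewrite fE; rewrite /g.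
    apply: cvg_EFin; first by near=> k.
    apply: cvgMr; rewrite indicE.
    have [z1|z1] := eqVneq (normc (toC z)) 1.
      rewrite mem_set// z1 expr1n; under eq_cvg do rewrite expr1n.
      exact: cvg_cst.
    rewrite memNset; last by move=> /= z1'; move/eqP: z1.
    apply: cvg_expr; rewrite ger0_norm ?sqr_ge0// expr_lt1 ?normc_ge0//.
    by rewrite lt_neqAle z1.
  - exact: integrable_normc_sqr.
  - apply: aeD => z Dz k _; have r0 : 0 <= normc (toC z) ^+ 2 by exact: sqr_ge0.
    rewrite fE gee0_abs ?lee_fin; last by rewrite mulr_ge0 ?sqr_ge0// exprn_ge0.
    by rewrite ler_piMr ?sqr_ge0// exprn_ile1// expr_le1// normc_ge0.
move=> cE.
have {}cE : energy mu (p * 'X^k) @[k --> \oo] --> energy (restr_circle mu) p.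
  by move: cE; rewrite -energy_restr_circle => /fine_cvg.
have : c * energy mu (p * 'X^k) @[k --> \oo] --> c * energy (restr_circle mu) p.
  exact: cvgMr.
move=> cc; rewrite -(cvg_lim _ cc)//; apply: limr_ge; first by apply/cvg_ex; eexists; exact: cc.
near=> k; apply: le_trans (hmu (n + k)%N (p * 'X^k)).
rewrite -(big_mkord xpredT (fun i => normc (p * 'X^k)`_i ^+ 2)).
rewrite (big_cat_nat (leq0n k) (leq_addl _ _))/=.
have -> : \sum_(k <= i < n + k) normc (p * 'X^k)`_i ^+ 2 = \sum_(i < n) normc p`_i ^+ 2.
  rewrite -{1}[k]add0n big_addn addnK big_mkord; apply: eq_bigr => i _.
  by rewrite coefMXn ltnNge leq_addl/= addnK.
by rewrite lerDr sumr_ge0// => i _; exact: sqr_ge0.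
Unshelve. all: by end_near. Qed.

End BoundTransfer.

(** * The theorem *)

(** Norms and entries [0,0] are monotone with respect to the set of valid bounds. *)
Section Comparison.
Variables (R : realType) (m1 m2 : {measure set (R * R) -> \bar R}) (c : R).
Hypotheses (fm1 : finite_moments m1) (fm2 : finite_moments m2) (c0 : 0 <= c).
Hypotheses (b1 : forall n, coef_bound m1 n c) (b2 : forall n, coef_bound m2 n c).

Lemma operator_norm_A_mono :
  (forall d, 0 <= d -> (forall n, coef_bound m1 n d) -> forall n, coef_bound m2 n d) ->
  operator_norm (A_matrix m2) <= operator_norm (A_matrix m1).
Proof.
move=> h; have d0 := operator_norm_A_ge0 fm1 c0 b1.
exact: (operator_norm_A_le fm2 d0 (h _ d0 (coef_bound_operator_norm fm1 c0 b1))).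
Qed.

Lemma A00_mono :
  (forall d, 0 <= d -> coef_bound m1 1 d -> coef_bound m2 1 d) ->
  normc (A_matrix m2 0 0) <= normc (A_matrix m1 0 0).
Proof.
move=> h; have d0 := normc_ge0 (A_matrix m1 0 0).
exact: (A00_le fm2 c0 b2 d0 (h _ d0 (coef_bound_A00 fm1 c0 b1))).
Qed.

End Comparison.

Theorem proposition4 (R : realType)
    (mu nu_a nu_s : {measure set (R * R) -> \bar R}) :
  finite_moments mu ->
  topological_support mu `<=` closed_disk R ->
  lebesgue_decomposition (restr_circle mu) nu_a nu_s ->
  0 < limn (smallest_eigenvalue mu) ->
  [/\ A_operator_exists mu,
      A_operator_exists (restr_circle mu)
    & A_operator_exists nu_a] /\
  (operator_norm (A_matrix mu) = operator_norm (A_matrix (restr_circle mu)) /\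
   operator_norm (A_matrix (restr_circle mu)) = operator_norm (A_matrix nu_a)) /\
  A_matrix (restr_circle mu) 0%N 0%N = A_matrix nu_a 0%N 0%N.
Proof.
move=> fmu supp [nuE _ sing] limn0; set nu := restr_circle mu.
have [c c0 bmu] := coef_bound_of_limn fmu limn0.
have outD := support_null supp.
have le_nu := @restr_circle_le R mu.
have le_a := le_nu_a nuE.
have fnu := finite_moments_le le_nu fmu.
have fa := finite_moments_le le_a fnu.
have down1 d : 0 <= d -> (forall n, coef_bound mu n d) -> forall n, coef_bound nu n d.
  by move=> d0; exact: coef_bound_restr_circle.
have down2 n d : 0 <= d -> coef_bound nu n d -> coef_bound nu_a n d.
  by move=> d0; apply: coef_bound_ac sing d0 => //; exact: restr_circleC.
have bnu := down1 c c0 bmu.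
have ba n := down2 n c c0 (bnu n).
have up1 n d : 0 <= d -> coef_bound nu n d -> coef_bound mu n d.
  by move=> d0; exact: coef_bound_le d0 le_nu fmu.
have up2 n d : 0 <= d -> coef_bound nu_a n d -> coef_bound nu n d.
  by move=> d0; exact: coef_bound_le d0 le_a fnu.
split; first by split; apply: coef_bound_A_operator_exists; eassumption.
split; [split; apply/eqP; rewrite eq_le; apply/andP; split|].
- by apply: (operator_norm_A_mono fnu fmu c0 bnu) => d d0 h n; exact: up1 (h n).
- exact: (operator_norm_A_mono fmu fnu c0 bmu down1).
- by apply: (operator_norm_A_mono fa fnu c0 ba) => d d0 h n; exact: up2 (h n).
- by apply: (operator_norm_A_mono fnu fa c0 bnu) => d d0 h n; exact: down2 (h n).
rewrite (A00_real fnu c0 bnu) (A00_real fa c0 ba); congr (_%:C)%C.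
apply/eqP; rewrite eq_le; apply/andP; split.
  exact: (A00_mono fa fnu c0 ba bnu (fun d => up2 1%N d)).
exact: (A00_mono fnu fa c0 bnu ba (fun d => down2 1%N d)).
Qed.
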